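(* Let $(R,z)\in\mathcal{T}_{\geq 3}$. Then $\varrho$ is an unbounded metric on $[(R,z)]$ such that, given $(T,v),(T',w)\in[(R,z)]$, $\varrho((T,v),(T',w))=0$ if and only if there is a rooted isometry between $(T,v)$ and $(T',w)$.
   Context: Trees: an $\mathbb{R}$-tree is a metric space $(T,d)$ that is uniquely arcwise connected and in which, for all $x,y\in T$, the unique arc $[x,y]$ from $x$ to $y$ is isometric to $[0,d(x,y)]$. A rooted $\mathbb{R}$-tree $(T,v)$ is an $\mathbb{R}$-tree with a point $v\in T$, the root. It is geodesically complete if every isometric embedding $f\colon[0,t]\to T$ with $t>0$, $f(0)=v$, extends to an isometric embedding $[0,\infty)\to T$. It is simplicial if $T$ is the geometric realization of a simplicial complex and every edge is isometric to $[0,1]$; the root of a simplicial tree is a vertex. A rooted isometry $(T,v)\to(T',w)$ is an isometry $T\to T'$ sending $v$ to $w$. End space: $end(T,v)$ is the set of isometric embeddings $F\colon[0,\infty)\to T$ with $F(0)=v$. For $F,G\in end(T,v)$, $(F|G)_v=\sup\{t\ge0 : F(t)=G(t)\}$ and $d_v(F,G)=e^{-(F|G)_v}$ (with $e^{-\infty}=0$), an ultrametric. Distortion: for a homeomorphism $f\colon X\to Y$ of metric spaces, $x_0\in X$, $\varepsilon>0$ and $S(x_0,\varepsilon)=\{x : d_X(x_0,x)=\varepsilon\}$, set $D_f(x_0,\varepsilon)=\frac{\sup\{d_Y(f(x_0),f(x)) : x\in S(x_0,\varepsilon)\}}{\inf\{d_Y(f(x_0),f(x)) : x\in S(x_0,\varepsilon)\}}$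 if $S(x_0,\varepsilon)\ne\emptyset$, and $D_f(x_0,\varepsilon)=1$ otherwise. $f$ has bounded distortion if $\sup_{x}\sup_{\varepsilon>0}D_f(x,\varepsilon)<\infty$, and is a bounded distortion equivalence if $f$ and $f^{-1}$ both have bounded distortion. The map $\varrho$: for rooted geodesically complete trees with bounded distortion equivalent end spaces, $\mathcal{K}_{(T,v),(T',w)}$ is the greatest lower bound of the $K$ for which there is a homeomorphism $f\colon end(T,v)\to end(T',w)$ with $\sup_{F}\sup_{\varepsilon>0}D_f(F,\varepsilon)\le K$ and $\sup_{F'}\sup_{\varepsilon>0}D_{f^{-1}}(F',\varepsilon)\le K$; and $\varrho((T,v),(T',w))=\ln(1+2\ln(\mathcal{K}_{(T,v),(T',w)}))$. Classes: $\mathcal{T}_{\ge3}$ is the class of rooted geodesically complete simplicial trees in which every vertex has valence at least $3$, considered up to rooted isometry. For $(R,z)\in\mathcal{T}_{\ge3}$, $[(R,z)]\subset\mathcal{T}_{\ge3}$ is the class of those trees quasi-isometric to $(R,z)$, i.e. (equivalently) those whose end space is bounded distortion equivalent to $end(R,z)$. *)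

(* Defs.v *)
From HB Require Import structures.
From mathcomp Require Import all_boot all_order all_algebra finmap.
From mathcomp Require Import all_classical all_reals all_analysis.

Set Implicit Arguments.
Unset Strict Implicit.
Unset Printing Implicit Defensive.

Import Order.TTheory GRing.Theory Num.Theory.
Import numFieldNormedType.Exports.

Local Open Scope classical_set_scope.
Local Open Scope ring_scope.

(* A continuous injection of the compact interval [0, 1] into a metric space is
   a homeomorphism onto its image, so [is_arc x y A] says that [A] is an arc
   with endpoints [x] and [y]. *)
Definition is_arc (R : realType) (T : metricType R) (x y : T) (A : set T) :=
  exists g : R -> T,
    [/\ {within `[0, 1], continuous g}, set_inj `[0, 1] g,
        g 0 = x, g 1 = y & g @` `[0, 1] = A].

Definition isometric_to_itv (R : realType) (T : metricType R) (A : set T)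
    (l : R) :=
  exists2 g : R -> T, g @` `[0, l] = A &
    forall s t, s \in `[0, l] -> t \in `[0, l] -> mdist (g s) (g t) = `|s - t|.

(* The degenerate case [x = y], where the arc is [set x], carries no
   information and is left out. *)
Definition is_Rtree (R : realType) (T : metricType R) :=
  forall x y : T, x <> y ->
    exists2 A, is_arc x y A &
      (forall B, is_arc x y B -> B = A) /\ isometric_to_itv A (mdist x y).

Record rooted_Rtree (R : realType) := RootedRtree {
  tree_carrier :> metricType R;
  tree_root : tree_carrier;
  tree_Rtree : is_Rtree tree_carrier
}.

Definition ray_isometry (R : realType) (T : metricType R)
    (F : {nonneg R} -> T) :=
  forall s t, mdist (F s) (F t) = `|s%:num - t%:num|.

Definition geodesically_complete (R : realType) (X : rooted_Rtree R) :=
  forall (t : R) (f : R -> X), 0 < t -> f 0 = tree_root X ->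
    (forall r s, r \in `[0, t] -> s \in `[0, t] -> mdist (f r) (f s) = `|r - s|) ->
    exists2 F : {nonneg R} -> X, ray_isometry F &
      forall s : {nonneg R}, s%:num <= t -> F s = f s%:num.

(* Every element of the type [V] is a vertex of the complex. *)
Record simplicial_complex (V : choiceType) := SimplicialComplex {
  simplex :> {fset V} -> Prop;
  simplex_neq0 : ~ simplex fset0;
  simplex1 : forall v, simplex [fset v]%fset;
  simplex_sub : forall s t : {fset V},
    (s `<=` t)%fset -> s != fset0 -> simplex t -> simplex s
}.

(* Points are given by their barycentric coordinates. *)
Definition realization (R : realType) (V : choiceType)
    (K : simplicial_complex V) : set (V -> R) :=
  [set a | exists2 s : {fset V}, K s &
     [/\ forall v, 0 <= a v, forall v, (a v != 0) = (v \in s)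
       & \sum_(v <- s) a v = 1]].

(* [T] is the geometric realization of a simplicial complex, through its
   barycentric coordinates [ss_coord]. The topology of the realization is its
   metric topology, which is the coarsest one making the barycentric
   coordinates continuous; the weak topology is not metrizable, hence not
   that of a metric tree, unless the complex is locally finite. *)
Record simplicial_structure (R : realType) (T : metricType R) :=
  SimplicialStructure {
  ss_vertex : choiceType;
  ss_complex : simplicial_complex ss_vertex;
  ss_coord : T -> ss_vertex -> R;
  ss_bij : set_bij [set: T] (realization ss_complex) ss_coord;
  ss_top : forall U : set T, open U <->
    exists2 W : set {ptws ss_vertex -> R}, open W & U = ss_coord @^-1` W;
  ss_edge : forall v w, v != w -> ss_complex [fset v; w]%fset ->
    isometric_to_itv
      [set x | forall u, u \notin [fset v; w]%fset -> ss_coord x u = 0] 1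
}.

Arguments ss_coord {R T} _ _ _.

Definition is_vertex (R : realType) (T : metricType R)
    (S : simplicial_structure T) (x : T) := exists v, ss_coord S x v = 1.

Definition neighbours (R : realType) (T : metricType R)
    (S : simplicial_structure T) (v : ss_vertex S) : set (ss_vertex S) :=
  [set w | v != w /\ ss_complex S [fset v; w]%fset].
Arguments neighbours {R T} S v.

Definition in_Tge3 (R : realType) (X : rooted_Rtree R) :=
  geodesically_complete X /\
  exists S : simplicial_structure X,
    is_vertex S (tree_root X) /\ forall v, (`I_3 #<= neighbours S v)%card.

Definition rooted_isometric (R : realType) (X Y : rooted_Rtree R) :=
  exists f : X -> Y,
    [/\ bijective f, forall x y, mdist (f x) (f y) = mdist x y
      & f (tree_root X) = tree_root Y].

Definition quasi_isometric (R : realType) (T T' : metricType R) :=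
  exists (f : T -> T') (L C : R),
    [/\ 1 <= L, 0 <= C,
        forall x y, L^-1 * mdist x y - C <= mdist (f x) (f y) <=
                    L * mdist x y + C
      & forall y, exists x, mdist (f x) y <= C].

Record end_space (R : realType) (X : rooted_Rtree R) := EndSpace {
  end_fun :> {nonneg R} -> X;
  end_isom : ray_isometry end_fun;
  end_root : end_fun 0%:nng = tree_root X
}.

Section end_metric.
Variables (R : realType) (X : rooted_Rtree R).
Implicit Types F G H : end_space X.

HB.instance Definition _ := gen_eqMixin (end_space X).
HB.instance Definition _ := gen_choiceMixin (end_space X).

Definition end_gprod F G : \bar R :=
  ereal_sup [set t%:num%:E | t in [set t : {nonneg R} | F t = G t]].

(* [expeR -oo = 0], so that the distance from an end to itself is 0. *)
Definition end_dist F G : R := fine (expeR (- end_gprod F G)).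

Lemma end_spaceP F G : (forall t, F t = G t) -> F = G.
Proof.
case: F G => [f fi f0] [g gi g0] /= /funext fg.
by case: _ / fg in gi g0 *; congr EndSpace; exact: Prop_irrelevance.
Qed.

Lemma end_fun0 F (t : {nonneg R}) : t%:num = 0 -> F t = tree_root X.
Proof. by move=> t0; rewrite -(end_root F); congr (_ _); exact/val_inj. Qed.

Lemma end_dist_root F (t : {nonneg R}) : mdist (tree_root X) (F t) = t%:num.
Proof. by rewrite -(end_root F) end_isom /= sub0r normrN ger0_norm. Qed.

Lemma ray_arc F (t : {nonneg R}) : 0 < t%:num ->
  is_arc (tree_root X) (F t)
    [set F s | s in [set s : {nonneg R} | s%:num <= t%:num]].
Proof.
move=> t0; exists (fun r => F `|r * t%:num|%:nng).
have dF r r' : mdist (F `|r * t%:num|%:nng) (F `|r' * t%:num|%:nng) =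
    `| `|r * t%:num| - `|r' * t%:num| | by rewrite end_isom.
split.
- apply: continuous_subspaceT => r.
  apply: (@metricType_numDomainType.cvgrPdist_lt R X R (nbhs r) _ _ _).2 => e e0.
  have rt : (fun r' : R => `|r' * t%:num|) @ r --> `|r * t%:num|.
    by apply: cvg_norm; apply: cvgM; [exact: cvg_id | exact: cvg_cst].
  move/cvgrPdist_lt : rt => /(_ e e0) rt; near=> r'; rewrite dF.
  by near: r'.
- move=> r r' /[!inE]/=; rewrite !in_itv/= => /andP[r0 _] /andP[r'0 _] rr'.
  have := dF r r'; rewrite rr' mdistxx => /esym/normr0_eq0/eqP.
  rewrite subr_eq0 !ger0_norm ?mulr_ge0// => /eqP.
  by move/(mulIf (lt0r_neq0 t0)).
- by apply: end_fun0; rewrite /= mul0r normr0.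
- by congr (end_fun _ _); apply/val_inj; rewrite /= mul1r ger0_norm.
- apply/seteqP; split=> [x [r /=]|_ [s /= st <-]].
    rewrite in_itv/= => /andP[r0 r1] <-; exists `|r * t%:num|%:nng => //=.
    by rewrite ger0_norm ?mulr_ge0// ler_piMl.
  exists (s%:num / t%:num).
    by rewrite /= in_itv/= divr_ge0//= ler_pdivrMr// mul1r.
  congr (end_fun _ _); apply/val_inj => /=.
  by rewrite divfK ?gt_eqF// ger0_norm.
Unshelve. all: by end_near. Qed.

Lemma end_agree_le F G (s t : {nonneg R}) :
  s%:num <= t%:num -> F t = G t -> F s = G s.
Proof.
move=> st FGt; have [t0|t0] := leP t%:num 0.
  have s0 : s%:num = 0 by apply/eqP; rewrite eq_le (le_trans st t0)/=.
  by rewrite !end_fun0.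
have rt : tree_root X <> F t.
  move=> E; move: t0; have := end_dist_root F t.
  by rewrite -E mdistxx => <-; rewrite ltxx.
have [A _ [Auniq _]] := tree_Rtree rt.
have AF := Auniq _ (ray_arc F t0).
have AG : [set G s | s in [set s : {nonneg R} | s%:num <= t%:num]] = A.
  by apply: Auniq; rewrite FGt; exact: ray_arc.
have : A (F s) by rewrite -AF; exists s.
rewrite -AG => -[s' /= _ E]; rewrite -E; congr (end_fun _ _); apply/val_inj.
by have := end_dist_root F s; rewrite -E end_dist_root.
Qed.

Lemma end_gprod_ge0 F G : (0 <= end_gprod F G)%E.
Proof. by apply: ereal_sup_ubound; exists 0%:nng => //=; rewrite !end_fun0. Qed.

Lemma end_gprod_refl F : end_gprod F F = +oo%E.
Proof.
apply/eqP; rewrite -leye_eq leNgt; apply/negP => FF.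
have [r rE] : exists r, end_gprod F F = r%:E.
  by move: FF (end_gprod_ge0 F F); case: (end_gprod F F) => // r; exists r.
have : ((`|r| + 1)%:E <= end_gprod F F)%E.
  by apply: ereal_sup_ubound; exists (`|r| + 1)%:nng.
by rewrite rE lee_fin leNgt (le_lt_trans (ler_norm _)) ?ltrDl.
Qed.

Lemma end_gprod_sym F G : end_gprod F G = end_gprod G F.
Proof.
by congr ereal_sup; apply/seteqP; split=> _ [t /= FG <-]; exists t => /=.
Qed.

Lemma end_gprod_min F G H :
  (mine (end_gprod F G) (end_gprod G H) <= end_gprod F H)%E.
Proof.
rewrite leNgt; apply/negP; rewrite lt_min => /andP[].
move=> /ereal_sup_gt[_ [t /= FG <-] t1] /ereal_sup_gt[_ [u /= GH <-] u1].
have [tu|ut] := leP t%:num u%:num.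
- move: t1; apply/negP; rewrite -leNgt; apply: ereal_sup_ubound.
  by exists t => //=; rewrite FG (end_agree_le tu GH).
- move: u1; apply/negP; rewrite -leNgt; apply: ereal_sup_ubound.
  by exists u => //=; rewrite (end_agree_le (ltW ut) FG).
Qed.

Lemma end_distE F G : (end_dist F G)%:E = expeR (- end_gprod F G).
Proof.
rewrite /end_dist fineK//.
by move: (end_gprod_ge0 F G); case: (end_gprod F G).
Qed.

Lemma end_dist_ge0 F G : 0 <= end_dist F G.
Proof. by rewrite -lee_fin end_distE expeR_ge0. Qed.

Lemma end_distxx F : end_dist F F = 0.
Proof. by rewrite /end_dist end_gprod_refl. Qed.

Lemma end_dist_positivity F G : end_dist F G = 0 -> F = G.
Proof.
move=> FG0; have : end_gprod F G = +oo%E.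
  have := end_distE F G; rewrite FG0 => /esym/eqP.
  by rewrite expeR_eq0; case: (end_gprod F G).
move=> FGy; apply: end_spaceP => t.
have : (t%:num%:E < end_gprod F G)%E by rewrite FGy ltry.
move=> /ereal_sup_gt[_ [u /= FGu <-]]; rewrite lte_fin => /ltW tu.
exact: end_agree_le FGu.
Qed.

Lemma end_dist_sym F G : end_dist F G = end_dist G F.
Proof. by rewrite /end_dist end_gprod_sym. Qed.

Lemma end_dist_ultra G F H :
  end_dist F H <= Num.max (end_dist F G) (end_dist G H).
Proof.
have := end_gprod_min F G H; rewrite ge_min le_max -!lee_fin !end_distE.
by rewrite !lee_expeR !leeN2.
Qed.

Lemma end_dist_triangle G F H :
  end_dist F H <= end_dist F G + end_dist G H.
Proof.
apply: (le_trans (end_dist_ultra G F H)).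
by rewrite ge_max lerDl lerDr !end_dist_ge0.
Qed.

HB.instance Definition _ := isMetric.Build R (end_space X)
  end_distxx end_dist_positivity end_dist_sym end_dist_triangle.

End end_metric.

Definition homeomorphism (S T : topologicalType) (f : S -> T) (g : T -> S) :=
  [/\ cancel f g, cancel g f, continuous f & continuous g].

(* The extended reals keep the suprema and infima meaningful without any
   boundedness hypothesis; since [0^-1 = +oo], a vanishing infimum gives an
   infinite distortion. *)
Definition distortion (R : realType) (S T : metricType R) (f : S -> T)
    (x0 : S) (e : R) : \bar R :=
  let sphere := [set x | mdist x0 x = e] in
  let D := [set (mdist (f x0) (f x))%:E | x in sphere] in
  if sphere == set0 then 1%E else (ereal_sup D / ereal_inf D)%E.

Definition sup_distortion (R : realType) (S T : metricType R) (f : S -> T)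
  : \bar R :=
  ereal_sup [set ereal_sup [set distortion f x e | e in [set e | 0 < e]]
            | x in [set: S]].

Definition distortion_bounds (R : realType) (X Y : rooted_Rtree R) : set R :=
  [set K | exists (f : end_space X -> end_space Y)
                  (g : end_space Y -> end_space X),
     [/\ homeomorphism f g, (sup_distortion f <= K%:E)%E
       & (sup_distortion g <= K%:E)%E]].

(* [distortion_bounds X Y] is nonempty exactly when the two end spaces are
   bounded distortion equivalent; otherwise [inf] takes a default value. *)
Definition dist_const (R : realType) (X Y : rooted_Rtree R) : R :=
  inf (distortion_bounds X Y).

Definition varrho (R : realType) (X Y : rooted_Rtree R) : R :=
  ln (1 + 2 * ln (dist_const X Y)).

Definition qi_class (R : realType) (X Y : rooted_Rtree R) : Prop :=
  in_Tge3 Y /\ quasi_isometric X Y.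

(* A metric on the quotient of [C] by the equivalence relation [E]. The last
   clause, that [d] depends only on the classes, follows from the others. *)
Definition is_metric_mod (R : realType) (U : Type) (C : U -> Prop)
    (E : U -> U -> Prop) (d : U -> U -> R) :=
  [/\ forall x y, C x -> C y -> 0 <= d x y,
      forall x y, C x -> C y -> (d x y = 0 <-> E x y),
      forall x y, C x -> C y -> d x y = d y x,
      forall x y z, C x -> C y -> C z -> d x z <= d x y + d y z
    & forall x x' y y', C x -> C x' -> C y -> C y' -> E x x' -> E y y' ->
        d x y = d x' y'].

(* Main.v *)
From HB Require Import structures.
Require Import Defs.
From mathcomp Require Import all_boot all_order all_algebra finmap.
From mathcomp Require Import all_classical all_reals all_analysis.
From mathcomp Require Import ring lra zify.

Set Implicit Arguments.
Unset Strict Implicit.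
Unset Printing Implicit Defensive.

Import Order.TTheory GRing.Theory Num.Theory.
Import numFieldNormedType.Exports.

Local Open Scope classical_set_scope.
Local Open Scope ring_scope.

(** In a geodesically complete simplicial tree whose vertices have valence at
    least three, two distinct ends separate at a vertex, at an integral height,
    and around every end all heights occur. The end space is thus encoded by a
    level space: a set with a symmetric ultrametric function [lev] with values in
    the integers, the distance of two distinct points being [e^-lev]. The
    distance of the points at heights [s] and [t] on the rays [F] and [G] is then
    [s + t - 2 * min(s, t, lev F G)], a fact recorded by the predicate [chart],
    from which the 0-hyperbolicity and the geodesics of the tree are read off.

    A bijection between level spaces has distortion at most [e^k] when the images
    of two points of a sphere lie, seen from the image of its centre, at levels
    that differ by at most [k]. Such a map is coarsely monotone on levels
    ([lev_bounded_mono]) and sends consecutive spheres to levels that differ by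
    at most [2 * k + 1] ([lev_bounded_jump]); it is therefore continuous, and
    maps with exponents [k1] and [k2] compose to a map with exponent
    [k1 + k2 + 2 * k1 * k2] ([lev_bounded_comp]). All distortions being powers of
    [e], the infimum in the definition of [varrho] is attained and
    [varrho = ln (1 + 2 * k)] for the least exponent [k] of an equivalence
    ([varrho_levels]). The bound for composites is the triangle inequality. For
    [k = 0] the levels are preserved, so that the bijection of the ends extends
    to a rooted isometry of the trees ([lev_equiv0_rooted_isometric]); conversely
    a rooted isometry preserves the levels of ends.

    For [varrho] to be given by such a minimum on a quasi-isometry class, a
    quasi-isometry must induce a bounded distortion equivalence of the ends
    ([boundary_equiv]). This rests on the stability of quasi-geodesics
    ([qi_morse]), which is elementary in a tree because every chain joining two
    points passes close to every point between them.

    For unboundedness, two trees quasi-isometric to [Z] are built from its level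
    space, for each positive integer [n], by the construction of the tree of a
    level space ([level_tree_Tge3]). In the first, the ball of radius
    [2 * n + 1] is contracted to the root. In the second, this ball is replaced
    by a tree whose vertices at height less than [n] have four children. An
    equivalence with exponent [k < n] would induce an injection from a set of
    [2 ^ (2 * n + 1)] children of the root of the first tree to the [4 ^ n]
    vertices at height [n] of the second ([distant_trees]). *)

(** * Level spaces *)

(** The end space of a simplicial tree is an ultrametric space whose non-zero
    distances are the powers [e^-n]. A level space records the exponents:
    [lev F G] is the height at which the distinct points [F] and [G] separate,
    and [lev F F] carries no information. *)
Record lev_space := LevSpace {
  lev_sort :> Type;
  lev : lev_sort -> lev_sort -> nat;
  lev_sym : forall F G, lev F G = lev G F;
  lev_ultra : forall n F G H, F = G \/ (n <= lev F G)%N ->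
    G = H \/ (n <= lev G H)%N -> F = H \/ (n <= lev F H)%N;
  lev_sphere : forall F n, exists2 G, F <> G & lev F G = n
}.

(** The root of the associated tree has valence at least three. *)
Definition root_branching (E : lev_space) := forall F : E, exists G H : E,
  [/\ F <> G, F <> H, G <> H & [/\ lev F G = 0, lev F H = 0 & lev G H = 0]%N].

(** [f] has distortion at most [e^k]. *)
Definition lev_bounded (E E' : lev_space) (k : nat) (f : E -> E') :=
  forall F0 F F', F0 <> F -> F0 <> F' -> lev F0 F = lev F0 F' ->
    (lev (f F0) (f F) <= lev (f F0) (f F') + k)%N.

(** The exponent form of a bounded distortion equivalence with constant
    [e^k] in both directions. *)
Definition lev_equiv (E E' : lev_space) (k : nat) :=
  exists (f : E -> E') (g : E' -> E),
    [/\ cancel f g, cancel g f, lev_bounded k f & lev_bounded k g].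

Lemma lev_equiv_sym (E E' : lev_space) k : lev_equiv E E' k -> lev_equiv E' E k.
Proof. by move=> [f [g [fg gf bf bg]]]; exists g, f. Qed.

Lemma lev_ultra_min (E : lev_space) n (F G H : E) : F <> H ->
  (n <= lev F G)%N -> (n <= lev G H)%N -> (n <= lev F H)%N.
Proof.
by move=> FH FG GH; have [//|//] := lev_ultra (or_intror FG) (or_intror GH).
Qed.

(** Two of the three pairwise levels of three points coincide, namely the
    smallest ones. *)
Lemma lev_isosceles (E : lev_space) (F G H : E) : F <> G -> F <> H ->
  (lev F G < lev G H)%N -> lev F G = lev F H.
Proof.
move=> FG FH lt; apply/eqP; rewrite eqn_leq; apply/andP; split.
  by apply: (@lev_ultra_min _ _ _ G) => //; exact: ltnW.
rewrite leqNgt; apply/negP => lt2.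
have : (lev F G < lev F G)%N.
  apply: (leq_trans (n := minn (lev G H) (lev F H))); first by rewrite leq_min lt.
  apply: (@lev_ultra_min _ _ _ H) => //; first by rewrite geq_minr.
  by rewrite lev_sym geq_minl.
by rewrite ltnn.
Qed.

Section bounded_maps.
Variables (E E' : lev_space) (k : nat) (f : E -> E').
Hypotheses (finj : injective f) (fb : lev_bounded k f).
Implicit Types F G : E.

Let fneq F G : F <> G -> f F <> f G. Proof. by move=> FG /finj. Qed.

(** A map of bounded distortion is coarsely monotone: compare the images of [F]
    and [F'] as seen from [F], which is equally far from [F0] and [F']. *)
Lemma lev_bounded_mono F0 F F' : F0 <> F -> F0 <> F' ->
  (lev F0 F <= lev F0 F')%N -> (lev (f F0) (f F) <= lev (f F0) (f F') + k)%N.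
Proof.
move=> n1 n2; rewrite leq_eqVlt => /orP[/eqP|lt]; first exact: fb.
have nFF' : F <> F' by move=> FF'; move: lt; rewrite FF' ltnn.
have e : lev F F0 = lev F F' by apply: lev_isosceles => //; [exact: nesym | rewrite lev_sym].
rewrite leqNgt; apply/negP => gt.
have e' : lev (f F') (f F0) = lev (f F') (f F).
  apply: lev_isosceles; [exact/nesym/fneq | exact/nesym/fneq |].
  by rewrite (lev_sym (f F')); apply: leq_trans gt; rewrite ltnS leq_addr.
have := fb (nesym n1) nFF' e.
rewrite (lev_sym (f F) (f F')) -e' (lev_sym (f F)) (lev_sym (f F')).
by rewrite leqNgt gt.
Qed.

Hypothesis fsurj : forall y, exists F, f F = y.

(** The images of consecutive spheres are close: a level strictly between them
    is attained in the target, hence comes from a sphere on one side or the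
    other, against coarse monotonicity. *)
Lemma lev_bounded_jump F0 F F' : F0 <> F -> F0 <> F' ->
  lev F0 F' = (lev F0 F).+1 ->
  (lev (f F0) (f F') <= lev (f F0) (f F) + (2 * k).+1)%N.
Proof.
move=> n1 n2 e; rewrite leqNgt; apply/negP => gt.
have [G nG eG] := lev_sphere (f F0) ((lev (f F0) (f F) + k).+1).
have [H fH] := fsurj G; rewrite -{G}fH in nG eG.
have nH : F0 <> H by move=> H0; apply: nG; rewrite H0.
have [le1|le2] := leqP (lev F0 H) (lev F0 F).
  by have := lev_bounded_mono nH n1 le1; rewrite eG; lia.
by have := lev_bounded_mono n2 nH; rewrite e eG => /(_ le2); lia.
Qed.

(** Iterating the previous lemma along intermediate spheres. *)
Lemma lev_bounded_steps j F0 F F' : F0 <> F -> F0 <> F' ->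
  lev F0 F' = (lev F0 F + j)%N ->
  (lev (f F0) (f F') <= lev (f F0) (f F) + k + j * (2 * k).+1)%N.
Proof.
elim: j F' => [|j IH] F' n1 n2 e.
  rewrite mul0n addn0; apply: fb => //.
  by rewrite e addn0.
have [G nG eG] := lev_sphere F0 (lev F0 F + j)%N.
have := IH _ n1 nG eG; have := lev_bounded_jump nG n2.
rewrite e eG addnS => /(_ erefl); lia.
Qed.

(** The sphere of level 0 is mapped near the root, since level 0 is attained
    in the target. *)
Lemma lev_bounded_root F0 F : F0 <> F -> lev F0 F = 0%N ->
  (lev (f F0) (f F) <= k)%N.
Proof.
move=> n e; have [G nG eG] := lev_sphere (f F0) 0.
have [H fH] := fsurj G; rewrite -{G}fH in nG eG.
have nH : F0 <> H by move=> H0; apply: nG; rewrite H0.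
by have := lev_bounded_mono n nH; rewrite e eG add0n; apply.
Qed.

(** Continuity of [f] with respect to the associated ultrametrics. *)
Lemma lev_bounded_cont F0 N : exists M, forall F, F0 <> F ->
  (M <= lev F0 F)%N -> (N <= lev (f F0) (f F))%N.
Proof.
have [G nG eG] := lev_sphere (f F0) (N + k).
have [H fH] := fsurj G; rewrite -{G}fH in nG eG.
have nH : F0 <> H by move=> H0; apply: nG; rewrite H0.
exists (lev F0 H) => F nF le; have := lev_bounded_mono nH nF le.
by rewrite eG leq_add2r.
Qed.

End bounded_maps.

(** The exponents [k1] and [k2] of two maps yield for their composite an exponent
    [k] with [1 + 2 * k = (1 + 2 * k1) * (1 + 2 * k2)], which is the triangle inequality
    for [varrho]. *)
Lemma lev_bounded_comp (E1 E2 E3 : lev_space) k1 k2 (f : E1 -> E2) (g : E2 -> E3) :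
  injective f -> bijective g -> lev_bounded k1 f -> lev_bounded k2 g ->
  lev_bounded (k1 + k2 + 2 * k1 * k2) (g \o f).
Proof.
move=> finj [g' gK g'K] bf bg F0 F F' n1 n2 e /=.
have ginj := can_inj gK.
have gsurj G : exists F, g F = G by exists (g' G).
have m1 : f F0 <> f F by move=> /finj.
have m2 : f F0 <> f F' by move=> /finj.
have [le|/ltnW le] := leqP (lev (f F0) (f F)) (lev (f F0) (f F')).
  by have := lev_bounded_mono ginj bg m1 m2 le; lia.
(* the images under [f] lie in spheres at most [k1] apart *)
have [j ej] : exists j, lev (f F0) (f F) = (lev (f F0) (f F') + j)%N.
  by exists (lev (f F0) (f F) - lev (f F0) (f F'))%N; lia.
have := lev_bounded_steps ginj bg gsurj m2 m1 ej.
have : (j <= k1)%N by have := bf _ _ _ n1 n2 e; lia.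
nia.
Qed.

Lemma lev_equiv_comp (E1 E2 E3 : lev_space) k1 k2 :
  lev_equiv E1 E2 k1 -> lev_equiv E2 E3 k2 ->
  lev_equiv E1 E3 (k1 + k2 + 2 * k1 * k2).
Proof.
move=> [f [g [fg gf bf bg]]] [f' [g' [fg' gf' bf' bg']]].
exists (f' \o f), (g \o g'); split.
- exact: can_comp.
- exact: can_comp.
- by apply: lev_bounded_comp => //; [exact: can_inj fg | exists g'].
- have -> : (k1 + k2 + 2 * k1 * k2 = k2 + k1 + 2 * k2 * k1)%N by lia.
  by apply: lev_bounded_comp => //; [exact: can_inj gf' | exists f].
Qed.

(** By induction on the level: consecutive spheres have images of increasing
    level, and of different levels because [g] does not separate a sphere. *)
Lemma lev_isometric_le (E E' : lev_space) (f : E -> E') (g : E' -> E) :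
  cancel f g -> lev_bounded 0 f -> lev_bounded 0 g ->
  forall F0 F, F0 <> F -> (lev F0 F <= lev (f F0) (f F))%N.
Proof.
move=> fg bf bg F0 F n; move e : (lev F0 F) => m.
elim: m F n e => // m IH F n e.
have [G nG eG] := lev_sphere F0 m.
have := IH _ nG eG; rewrite leq_eqVlt => /orP[/eqP eq|lt]; last first.
  have := lev_bounded_mono (can_inj fg) bf nG n.
  by rewrite e eG addn0 => /(_ (leqnSn _)); exact: leq_trans.
have := lev_bounded_mono (can_inj fg) bf nG n.
rewrite e eG addn0 => /(_ (leqnSn _)); rewrite -eq leq_eqVlt => /orP[/eqP eq2|//].
have := bg (f F0) (f F) (f G); rewrite !fg addn0 e eG -eq2 -eq.
move=> /(_ _ _ erefl); rewrite ltnn => -> //.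
- by move=> /(can_inj fg).
- by move=> /(can_inj fg).
Qed.

(** Without distortion the spheres are permuted monotonically, hence fixed. *)
Lemma lev_equiv0_isometric (E E' : lev_space) (f : E -> E') (g : E' -> E) :
  cancel f g -> cancel g f -> lev_bounded 0 f -> lev_bounded 0 g ->
  forall F0 F, F0 <> F -> lev (f F0) (f F) = lev F0 F.
Proof.
move=> fg gf bf bg F0 F n; apply/eqP; rewrite eqn_leq.
rewrite (lev_isometric_le fg) ?andbT//.
have m : f F0 <> f F by move=> /(can_inj fg).
by have := lev_isometric_le gf bg bf m; rewrite !fg.
Qed.

(** * Gromov products and real trees *)

Section gromov_product.
Variables (R : realType) (T : metricType R).
Implicit Types (p x y z w : T) (g : R -> T).
Local Notation d := (@mdist R T).

(** The Gromov product of [x] and [y] based at [p]: in a tree, the distance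
    from [p] to the segment [x, y]. It vanishes when [p] lies between [x] and
    [y]. *)
Definition gpr p x y : R := (d p x + d p y - d x y) / 2.

Lemma gpr_sym p x y : gpr p x y = gpr p y x.
Proof. by rewrite /gpr (metric_sym x y) [d p x + _]addrC. Qed.

Lemma gpr_ge0 p x y : 0 <= gpr p x y.
Proof. by have := metric_triangle x p y; rewrite /gpr (metric_sym x p); lra. Qed.

Lemma gpr_lip p x y z : gpr p x z <= gpr p y z + d x y.
Proof.
have := metric_triangle p y x; have := metric_triangle y x z.
by rewrite /gpr (metric_sym y x); lra.
Qed.

Lemma gpr_swap w x y : gpr w x y = d w x - gpr x w y.
Proof. by rewrite /gpr (metric_sym x w); lra. Qed.

Lemma gpr_lel p x y : gpr p x y <= d p x.
Proof. by rewrite gpr_swap lerBlDr lerDl gpr_ge0. Qed.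

Lemma gpr_lip_base p q x y : gpr p x y <= gpr q x y + d p q.
Proof.
have := metric_triangle p q x; have := metric_triangle p q y.
by rewrite /gpr; lra.
Qed.

(** Gromov's 0-hyperbolicity. *)
Definition tree_like := forall p x y z,
  Num.min (gpr p x y) (gpr p y z) <= gpr p x z.

(** The four-point inequality is symmetric in its points, so it suffices to
    check it at one base point. *)
Lemma tree_like_base w :
  (forall x y z, Num.min (gpr w x y) (gpr w y z) <= gpr w x z) -> tree_like.
Proof.
move=> tl p x y z.
have tl' a b c r : r <= gpr w a b -> r <= gpr w b c -> r <= gpr w a c.
  by move=> ab bc; apply: le_trans (tl a b c); rewrite le_min ab.
suff H : gpr w x z + gpr w y p >= gpr w x y + gpr w z p \/
         gpr w x z + gpr w y p >= gpr w y z + gpr w x p.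
  rewrite ge_min; apply/orP; have := metric_sym y p; have := metric_sym z p.
  have := metric_sym x p; rewrite /gpr in H *.
  by case: H => H; [left|right]; lra.
(* according to which of the four products on the right is the largest *)
have xy_max : gpr w y z <= gpr w x y -> gpr w x p <= gpr w x y ->
    gpr w x z + gpr w y p >= gpr w y z + gpr w x p.
  move=> h1 h2; apply: lerD; first by apply: (tl' _ y).
  by apply: (tl' _ x); rewrite // (gpr_sym w y x).
have zp_max : gpr w y z <= gpr w z p -> gpr w x p <= gpr w z p ->
    gpr w x z + gpr w y p >= gpr w y z + gpr w x p.
  move=> h1 h2; rewrite addrC; apply: lerD; last by apply: (tl' _ z).
  by apply: (tl' _ p); rewrite // (gpr_sym w p z).
have yz_max : gpr w x y <= gpr w y z -> gpr w z p <= gpr w y z ->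
    gpr w x z + gpr w y p >= gpr w x y + gpr w z p.
  by move=> h1 h2; apply: lerD; [apply: (tl' _ y)|apply: (tl' _ z)].
have xp_max : gpr w x y <= gpr w x p -> gpr w z p <= gpr w x p ->
    gpr w x z + gpr w y p >= gpr w x y + gpr w z p.
  move=> h1 h2; rewrite addrC; apply: lerD.
    by apply: (tl' _ p); rewrite // (gpr_sym w p z).
  by apply: (tl' _ x); rewrite // (gpr_sym w y x).
have [h1|/ltW h1] := leP (gpr w x y) (gpr w z p);
have [h2|/ltW h2] := leP (gpr w y z) (gpr w x p).
- have [h3|/ltW h3] := leP (gpr w z p) (gpr w x p).
    by left; apply: xp_max; lra.
  by right; apply: zp_max; lra.
- have [h3|/ltW h3] := leP (gpr w z p) (gpr w y z).
    by left; apply: yz_max; lra.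
  by right; apply: zp_max; lra.
- have [h3|/ltW h3] := leP (gpr w x y) (gpr w x p).
    by left; apply: xp_max; lra.
  by right; apply: xy_max; lra.
- have [h3|/ltW h3] := leP (gpr w x y) (gpr w y z).
    by left; apply: yz_max; lra.
  by right; apply: xy_max; lra.
Qed.

(** [g] embeds the interval [0, a] isometrically. *)
Definition iso_on (a : R) g := forall s t : R, 0 <= s <= a -> 0 <= t <= a ->
  d (g s) (g t) = `|s - t|.

(** Any two points are joined by an isometrically embedded interval. *)
Definition geodesic := forall x y, exists g,
  [/\ iso_on (d x y) g, g 0 = x & g (d x y) = y].

Lemma iso_onE a g s t : iso_on a g -> 0 <= s -> s <= t -> t <= a ->
  d (g s) (g t) = t - s.
Proof.
by move=> gi s0 st ta; rewrite gi 1?distrC ?ger0_norm ?subr_ge0//; lra.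
Qed.

Lemma gpr0_mid p x y : gpr p x y = 0 <-> d x y = d p x + d p y.
Proof. by rewrite /gpr; split; lra. Qed.

Lemma iso_on_mid a g s t r : iso_on a g -> 0 <= s -> s <= t -> t <= r ->
  r <= a -> gpr (g t) (g s) (g r) = 0.
Proof.
move=> gi s0 st tr ra; apply/gpr0_mid; rewrite (metric_sym (g t) (g s)).
by rewrite !(iso_onE gi); lra.
Qed.

(** The median of a triangle, on any geodesic side. *)
Lemma tree_median a x y z g : tree_like -> iso_on a g -> g 0 = x -> g a = y ->
  0 <= a ->
  let p := g (gpr x y z) in
  [/\ gpr p x y = 0, gpr p x z = 0, gpr p y z = 0 & d x p = gpr x y z].
Proof.
move=> tl gi g0 ga a0 p; set h := gpr x y z.
have h0 : 0 <= h by exact: gpr_ge0.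
have xy : d x y = a by rewrite -g0 -ga (iso_onE gi) ?subr0.
have ha : h <= a by rewrite -xy gpr_lel.
have xp : d x p = h by rewrite -g0 (iso_onE gi) ?subr0.
have py : d p y = a - h by rewrite -ga (iso_onE gi).
have hpz : gpr x p z = h.
  apply/le_anti/andP; split; first by apply: le_trans (gpr_lel _ _ _) _; rewrite xp.
  apply: le_trans (tl _ _ y _).
  by rewrite le_min lexx andbT /gpr xp xy py; lra.
have pz : h + d x z - d p z = 2 * h by move: hpz; rewrite /gpr xp; lra.
have hE : 2 * h = a + d x z - d y z by rewrite /h /gpr xy; lra.
by split => //; apply/gpr0_mid; rewrite ?(metric_sym p x) ?xp ?py ?xy; lra.
Qed.

End gromov_product.

Section paths.
Variables (R : realType) (T : metricType R).
Implicit Types (p x y z w : T) (g : R -> T).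
Local Notation d := (@mdist R T).

(** A property of the points of an interval that is locally constant is
    constant. *)
Lemma locally_constant (P : R -> Prop) (a b : R) : a <= b ->
  (forall r : R, a <= r <= b -> exists2 e : R, 0 < e &
    forall s : R, a <= s <= b -> `|r - s| < e -> (P r <-> P s)) ->
  P a -> P b.
Proof.
move=> ab loc Pa; apply: contrapT => nPb.
pose h (r : R) : R := if `[< P r >] then 1 else 0.
have hc : {within `[a, b], continuous h}.
  apply/subspace_continuousP => r /=; rewrite in_itv/= => rab.
  have [e e0 He] := loc r rab.
  apply/cvgrPdist_lt => eps eps0; rewrite near_withinE.
  exists e => //= s /= rs; rewrite in_itv/= => sab.
  suff hs : h s = h r.
    have H : `|h r - h s| < eps by rewrite hs subrr normr0.
    exact: H.
  rewrite /h; congr (if _ then _ else _).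
  by apply/asbool_equiv_eq; apply: iff_sym; exact: He.
(* the indicator of [P] is continuous, so it would take the value 1/2 *)
have [|c _ hc2] := @IVT R h a b (1/2) ab hc.
  rewrite /h (asboolT Pa) (asboolF nPb) minC maxC.
  by rewrite min_l ?max_r ?ler01//; lra.
by move: hc2; rewrite /h; case: ifP => _; lra.
Qed.

(** Continuity of the restriction of [g] to [a, b], which passes to
    subintervals. *)
Definition cont_on (a b : R) g := forall r : R, a <= r <= b ->
  forall e : R, 0 < e -> exists2 del : R, 0 < del &
    forall s : R, a <= s <= b -> `|r - s| < del -> d (g r) (g s) < e.

Lemma within_cont_on a b g : {within `[a, b], continuous g} -> cont_on a b g.
Proof.
move=> /subspace_continuousP gc r rab e e0.
have rI : [set` `[a, b]] r by rewrite /= in_itv.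
have /metricType_numDomainType.cvgrPdist_lt/(_ e e0) := gc r rI.
rewrite near_withinE => -[del /= del0 H]; exists del => // s sab rs.
by apply: H => //=; rewrite in_itv.
Qed.

Lemma cont_on_within a b g : cont_on a b g -> {within `[a, b], continuous g}.
Proof.
move=> gc; apply/subspace_continuousP => r /=; rewrite in_itv/= => rab.
apply/metricType_numDomainType.cvgrPdist_lt => e e0; have [del del0 H] := gc r rab e e0.
rewrite near_withinE; exists del => //= s /= rs.
by rewrite in_itv/= => sab; exact: H.
Qed.

Lemma cont_on_sub a b a' b' g : a <= a' -> b' <= b -> cont_on a b g ->
  cont_on a' b' g.
Proof.
move=> aa bb gc r rab e e0; have [|del del0 H] := gc r _ e e0; first by lra.
by exists del => // s sab; apply: H; lra.
Qed.

(** Paths in a tree pass through every point between their endpoints. *)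
Lemma tree_between a b g z : tree_like T -> a <= b -> cont_on a b g ->
  gpr z (g a) (g b) = 0 -> exists2 s, a <= s <= b & g s = z.
Proof.
move=> tl ab gc z0; apply: contrapT => /forall2NP nz.
have nd s : a <= s <= b -> 0 < d z (g s).
  by move=> sab; rewrite mdist_gt0; apply/eqP => E; case: (nz s) => // /(_ (esym E)).
(* the points on the same side of [z] as [g a] form a clopen set *)
have gaa x : gpr z x x = d z x by rewrite /gpr mdistxx; lra.
have : 0 < gpr z (g a) (g b).
  apply: (@locally_constant (fun s => 0 < gpr z (g a) (g s)) a b) => //; last first.
    by rewrite gaa nd ?lexx.
  move=> r rab; have [del del0 H] := gc r rab _ (nd r rab).
  exists del => // s sab rs; have rs0 : 0 < gpr z (g r) (g s).
    by have := H s sab rs; have := nd s sab; rewrite /gpr; lra.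
  split=> lt0.
    by apply: lt_le_trans (tl z _ (g r) _); rewrite lt_min lt0.
  by apply: lt_le_trans (tl z _ (g s) _); rewrite lt_min lt0 gpr_sym.
by rewrite z0 ltxx.
Qed.

(** [g] is 1-Lipschitz on [0, a]. *)
Definition unit_lip (a : R) g := forall s t : R, 0 <= s -> s <= t -> t <= a ->
  d (g s) (g t) <= t - s.

Lemma lip_arc a g : 0 < a -> unit_lip a g ->
  (forall s t : R, 0 <= s <= a -> 0 <= t <= a -> g s = g t -> s = t) ->
  is_arc (g 0) (g a) (g @` `[0, a]).
Proof.
move=> a0 gl gi; exists (fun r => g (r * a)).
have sc r : 0 <= r <= 1 -> 0 <= r * a <= a.
  by move=> /andP[r0 r1]; rewrite mulr_ge0 ?(ltW a0)//= ler_piMl// ltW.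
have dl s t : 0 <= s <= a -> 0 <= t <= a -> d (g s) (g t) <= `|s - t|.
  move=> sa ta; have [st|/ltW ts] := leP s t.
    by rewrite distrC ger0_norm ?subr_ge0// gl//; lra.
  by rewrite metric_sym ger0_norm ?subr_ge0// gl//; lra.
split.
- apply: cont_on_within => r r01 e e0; exists (e / a); first by rewrite divr_gt0.
  move=> s s01 rs; apply: le_lt_trans (dl _ _ (sc _ r01) (sc _ s01)) _.
  by rewrite -mulrBl normrM (gtr0_norm a0) -ltr_pdivlMr.
- move=> r s /[!inE]/=; rewrite !in_itv/= => r01 s01 /gi.
  by move=> /(_ (sc _ r01) (sc _ s01)); apply: mulIf; rewrite gt_eqF.
- by rewrite mul0r.
- by rewrite mul1r.
- apply/seteqP; split=> [_ [r /= + <-]|_ [r /= + <-]]; rewrite in_itv/= => rI.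
    by exists (r * a) => //=; rewrite in_itv/= sc.
  exists (r / a); last by rewrite divfK// gt_eqF.
  rewrite /= in_itv/= divr_ge0 ?ler_pdivrMr ?mul1r//; [by case/andP: rI..|exact: ltW].
Qed.

Lemma iso_on_lip a g : iso_on a g -> unit_lip a g.
Proof. by move=> gi s t s0 st ta; rewrite (iso_onE gi). Qed.

Lemma iso_on_inj a g : iso_on a g ->
  forall s t : R, 0 <= s <= a -> 0 <= t <= a -> g s = g t -> s = t.
Proof.
move=> gi s t sa ta E; have := gi s t sa ta; rewrite E mdistxx.
by move/esym/normr0_eq0/eqP; rewrite subr_eq0 => /eqP.
Qed.

(** An arc passes through every point of the segment between its endpoints;
    applied to its two subarcs ended by one of its points, this shows that it
    contains nothing else. *)
Lemma tree_like_Rtree : tree_like T -> geodesic T -> is_Rtree T.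
Proof.
move=> tl geo x y xy; have [g [gi g0 gl]] := geo x y.
have l0 : 0 < d x y by rewrite mdist_gt0; apply/eqP.
exists (g @` `[0, d x y]).
  by have := lip_arc l0 (iso_on_lip gi) (iso_on_inj gi); rewrite g0 gl.
split; last first.
  by exists g => // s t; rewrite !in_itv/= => sI tI; exact: gi.
move=> B [h [/within_cont_on hc hinj h0 h1 <-]].
apply/seteqP; split=> [_ [s /= + <-]|_ [s /= + <-]]; rewrite in_itv/= => sI.
  (* [c] is the projection of [h s] to the segment; the path [h] meets it both
     before and after [s] *)
  pose c := g (gpr x y (h s)).
  have [cxy cxs cys _] := tree_median (h s) tl gi g0 gl (ltW l0).
  have [| | |r rs hr] := @tree_between 0 s h c tl; first by lra.
  - by apply: cont_on_sub hc; lra.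
  - by rewrite h0.
  have [| | |r' rs' hr'] := @tree_between s 1 h c tl; first by lra.
  - by apply: cont_on_sub hc; lra.
  - by rewrite h1 gpr_sym.
  have rr' : r = r'.
    by apply: hinj; [rewrite inE/= in_itv/=; lra..|rewrite hr hr'].
  have sr : s = r by lra.
  exists (gpr x y (h s)); last by rewrite -/c -hr sr.
  by rewrite /= in_itv/= gpr_ge0 gpr_lel.
have [//| //| |r rI hr] := @tree_between 0 1 h (g s) tl.
  rewrite h0 h1 -g0 -gl; apply: (iso_on_mid gi) => //; lra.
by exists r => //=; rewrite in_itv.
Qed.

End paths.

Section Rtree_geometry.
Variables (R : realType) (T : metricType R).
Hypothesis hT : is_Rtree T.
Implicit Types (x y z : T) (f g h : R -> T).
Local Notation d := (@mdist R T).

Lemma Rtree_arc_ends x y A : x <> y -> is_arc x y A ->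
  exists g, [/\ iso_on (d x y) g, g @` `[0, d x y] = A, g 0 = x & g (d x y) = y].
Proof.
move=> xy arcA; have [B arcB [uniq [g gB gi]]] := hT xy.
rewrite -(uniq _ arcA) in gB.
have {}gi : iso_on (d x y) g by move=> s t sI tI; apply: gi; rewrite in_itv.
have [Ax Ay] : A x /\ A y.
  have [h [_ _ h0 h1 <-]] := arcA.
  by split; [exists 0|exists 1] => //=; rewrite in_itv/= ler01 lexx.
have l0 : 0 < d x y by rewrite mdist_gt0; apply/eqP.
move: Ax Ay; rewrite -gB => -[s /=] + gs [t /=] + gt.
rewrite !in_itv/= => sI tI; have := gi s t sI tI; rewrite gs gt.
have [st|st] := leP s t => dst.
  have [s0 t0] : s = 0 /\ t = d x y.
    by move: dst; rewrite distrC ger0_norm ?subr_ge0// => dst; split; lra.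
  by exists g; split => //; [rewrite -s0 gs|rewrite -t0 gt].
have [s0 t0] : t = 0 /\ s = d x y.
  by move: dst; rewrite ger0_norm ?subr_ge0 ?ltW// => dst; split; lra.
exists (fun r => g (d x y - r)); split.
- move=> r r' rI rI'; rewrite gi; [|lra|lra].
  by rewrite (_ : _ - _ = r' - r) 1?distrC//; ring.
- apply/seteqP; split=> [_ [r /= + <-]|_ [r /= + <-]]; rewrite in_itv/= => rI.
    by exists (d x y - r) => //=; rewrite in_itv/=; lra.
  exists (d x y - r); first by rewrite /= in_itv/=; lra.
  by congr g; ring.
- by rewrite subr0 -t0 gs.
- by rewrite subrr -s0 gt.
Qed.

Lemma Rtree_geodesic : geodesic T.
Proof.
move=> x y; have [->|xy] := pselect (x = y).
  exists (fun=> y); split => // s t; rewrite !mdistxx => sI tI.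
  by rewrite (_ : s = t) ?subrr ?normr0//; lra.
have [A arcA _] := hT xy.
by have [g [gi _ g0 g1]] := Rtree_arc_ends xy arcA; exists g.
Qed.

(** Every point of an arc lies between its endpoints. *)
Lemma Rtree_arc_mid x y z A : x <> y -> is_arc x y A -> A z -> gpr z x y = 0.
Proof.
move=> xy arcA; have [g [gi <- g0 g1]] := Rtree_arc_ends xy arcA.
move=> [r /= + <-]; rewrite in_itv/= => rI.
by rewrite -g0 -g1; apply: (iso_on_mid gi); lra.
Qed.

(** Geodesics that only meet at a common endpoint concatenate to a geodesic. *)
Lemma Rtree_concat (a b : R) f h : 0 <= a -> 0 <= b -> iso_on a f ->
  iso_on b h -> f a = h 0 ->
  (forall s t : R, 0 <= s <= a -> 0 <= t <= b -> f s = h t -> s = a) ->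
  d (f 0) (h b) = a + b.
Proof.
move=> a0 b0 fi hi fh dis.
move: (a0); rewrite le_eqVlt => /orP[/eqP a00|a_gt0].
  by rewrite {1}a00 fh (iso_onE hi)//; lra.
pose g r := if r <= a then f r else h (r - a).
have gl : unit_lip (a + b) g.
  move=> s t s0 st tab; rewrite /g; have [ta|at_] := leP t a.
    by rewrite (le_trans st ta) (iso_onE fi).
  have [sa|as_] := leP s a; last by rewrite (iso_onE hi); lra.
  apply: le_trans (metric_triangle _ (f a) _) _.
  by rewrite (iso_onE fi)// fh (iso_onE hi); lra.
have gi (s t : R) : 0 <= s <= a + b -> 0 <= t <= a + b -> g s = g t -> s = t.
  move=> sI tI; rewrite /g; have [sa|as_] := leP s a; have [ta|at_] := leP t a.
  - by apply: (iso_on_inj fi); lra.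
  - move=> E; have sa' : s = a by apply: dis E; lra.
    move: E; rewrite sa' fh => /(iso_on_inj hi) E.
    have {}E : 0 = t - a by apply: E; lra.
    lra.
  - move=> /esym E; have sa' : t = a by apply: dis E; lra.
    move: E; rewrite sa' fh => /(iso_on_inj hi) E.
    have {}E : 0 = s - a by apply: E; lra.
    lra.
  - move=> /(iso_on_inj hi) E.
    have {}E : s - a = t - a by apply: E; lra.
    lra.
have arc := @lip_arc R T (a + b) g _ gl gi.
have g0 : g 0 = f 0 by rewrite /g a0.
have gab : g (a + b) = h b.
  rewrite /g; have [le|_] := leP; last by congr h; ring.
  by rewrite (_ : b = 0) ?addr0//; lra.
have ga : g a = f a by rewrite /g lexx.
rewrite g0 gab in arc.
have ne : f 0 <> h b.
  rewrite -g0 -gab => /gi E; have {}E : 0 = a + b by apply: E; lra.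
  lra.
have /gpr0_mid -> : gpr (f a) (f 0) (h b) = 0.
  apply: (Rtree_arc_mid ne (arc _)); first by lra.
  by exists a; rewrite //= in_itv/=; lra.
by rewrite metric_sym (iso_onE fi)// fh (iso_onE hi)//; lra.
Qed.

End Rtree_geometry.

(** * Rays from the root *)

Section rays.
Variables (R : realType) (X : rooted_Rtree R).
Implicit Types (F G : end_space X) (s t u : R).
Local Notation d := (@mdist R X).

(** The point at height [t] on the ray [F], for [t >= 0]. *)
Definition ev F t : X := F `|t|%:nng.

Lemma evE F (t : {nonneg R}) : F t = ev F t%:num.
Proof. by congr (end_fun _ _); apply/val_inj; rewrite /= ger0_norm. Qed.

Lemma ev_dist F s t : 0 <= s -> 0 <= t -> d (ev F s) (ev F t) = `|s - t|.
Proof. by move=> s0 t0; rewrite end_isom /= (ger0_norm s0) (ger0_norm t0). Qed.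

Lemma ev_iso F t : iso_on t (ev F).
Proof. by move=> s r /andP[s0 _] /andP[r0 _]; exact: ev_dist. Qed.

Lemma ev0 F : ev F 0 = tree_root X.
Proof. by apply: end_fun0; rewrite /= normr0. Qed.

Lemma ev_height F t : 0 <= t -> d (tree_root X) (ev F t) = t.
Proof. by move=> t0; rewrite -(ev0 F) ev_dist// sub0r normrN ger0_norm. Qed.

Lemma ev_inj F G s t : 0 <= s -> 0 <= t -> ev F s = ev G t -> s = t.
Proof. by move=> s0 t0 E; rewrite -(ev_height F s0) E ev_height. Qed.

Lemma ev_agree_le F G s t : 0 <= s -> s <= t -> ev F t = ev G t ->
  ev F s = ev G s.
Proof. by move=> s0 st; apply: end_agree_le; rewrite /= !ger0_norm//; lra. Qed.

Lemma ev_ext F G : (forall t, 0 <= t -> ev F t = ev G t) -> F = G.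
Proof. by move=> FG; apply: end_spaceP => t; rewrite !evE FG. Qed.

(** A ray given by a function on the whole real line, whose values at negative
    reals are irrelevant. *)
Lemma ev_mk (g : R -> X) : g 0 = tree_root X -> (forall a, iso_on a g) ->
  exists F, forall t, 0 <= t -> ev F t = g t.
Proof.
move=> g0 gi.
have Fi : ray_isometry (fun t : {nonneg R} => g t%:num).
  move=> s t; apply: (gi (s%:num + t%:num)); apply/andP; split => //.
    by rewrite lerDl.
  by rewrite lerDr.
by exists (EndSpace Fi g0) => t t0; rewrite /ev /= ger0_norm.
Qed.

Lemma ray_extend (a : R) (g : R -> X) : geodesically_complete X -> 0 < a ->
  g 0 = tree_root X -> iso_on a g ->
  exists F, forall t, 0 <= t <= a -> ev F t = g t.
Proof.
move=> gc a0 g0 gi; have [|f fi fE] := gc a g a0 g0.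
  by move=> r s; rewrite !in_itv/=; exact: gi.
have f0 : f 0%:nng = tree_root X by rewrite fE //= ltW.
exists (EndSpace fi f0) => t /andP[t0 ta].
by rewrite /ev /= fE /= ger0_norm.
Qed.

(** Two rays that separate at height [c] span a tripod. *)
Lemma ev_tripod F G c : 0 <= c ->
  (forall u, 0 <= u -> ev F u = ev G u <-> u <= c) ->
  forall s t, 0 <= s -> 0 <= t ->
  d (ev F s) (ev G t) = s + t - 2 * Num.min (Num.min s t) c.
Proof.
move=> c0 FGc s t s0 t0.
have [sc|cs] := leP s c.
  rewrite ((FGc s s0).2 sc) ev_dist//.
  have [st|ts] := leP s t.
    by rewrite min_l// distrC ger0_norm ?subr_ge0//; lra.
  by rewrite min_l; [rewrite ger0_norm ?subr_ge0 ?ltW//; lra|lra].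
have [tc|ct] := leP t c.
  rewrite -((FGc t t0).2 tc) ev_dist// (_ : Num.min _ _ = t); last first.
    by rewrite (min_r (y := t)) ?min_l//; lra.
  by rewrite ger0_norm ?subr_ge0//; lra.
rewrite min_r; last by rewrite le_min !ltW.
have Fi : iso_on (s - c) (fun r => ev F (s - r)).
  move=> r r' rI rI'; rewrite ev_dist; [|lra|lra].
  by rewrite (_ : _ - _ = r' - r) 1?distrC//; ring.
have Gi : iso_on (t - c) (fun r => ev G (c + r)).
  move=> r r' rI rI'; rewrite ev_dist; [|lra|lra].
  by rewrite (_ : _ - _ = r - r')//; ring.
have := Rtree_concat (tree_Rtree (r := X)) _ _ Fi Gi.
rewrite subr0 addr0 (_ : s - (s - c) = c); last by ring.
rewrite (_ : c + (t - c) = t); last by ring.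
move=> ->; [ring|lra|lra|exact: (FGc c c0).2|].
move=> r r' rI rI' E; have e : s - r = c + r' by apply: ev_inj E; lra.
have : s - r <= c by apply: (FGc _ _).1; [lra|rewrite {2}e].
by lra.
Qed.

End rays.

(** * Simplicial trees *)

Lemma card3P (U : Type) (A : set U) : (`I_3 #<= A)%card <->
  exists a b c, [/\ A a, A b & A c] /\ [/\ a <> b, a <> c & b <> c].
Proof.
split=> [/card_leP[f]|[a [b [c [[Aa Ab Ac] [ab ac bc]]]]]].
  have i0 : 0%N \in `I_3 by rewrite inE.
  have i1 : 1%N \in `I_3 by rewrite inE.
  have i2 : 2%N \in `I_3 by rewrite inE.
  have fi u v : val (f u) = val (f v) -> val u = val v.
    by move=> /val_inj E; congr val; apply: (@inj _ _ _ f) E; rewrite inE.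
  exists (val (f (SigSub i0))), (val (f (SigSub i1))), (val (f (SigSub i2))).
  by split; split; do ?[exact: set_valP | by move/fi].
pose h i := nth a [:: a; b; c] i.
have hi : {in `I_3 &, injective h}.
  by move=> [|[|[|i]]] [|[|[|j]]] /[!inE]//= _ _; rewrite /h //=; do ?by [|move/esym].
apply: card_le_trans (_ : (h @` `I_3 #<= _)%card); last first.
  by apply: subset_card_le => _ [[|[|[|i]]] //= _ <-].
by have := inj_card_eq hi; rewrite card_eq_sym => /card_eqPle[].
Qed.

Section real_paths.
Variables (R : realType).

Lemma ivt_eps (f : R -> R) (a b v : R) : a <= b ->
  (forall r : R, a <= r <= b -> forall e : R, 0 < e -> exists2 del : R, 0 < del &
    forall s : R, a <= s <= b -> `|r - s| < del -> `|f r - f s| < e) ->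
  (f a <= v <= f b) \/ (f b <= v <= f a) -> exists2 c, a <= c <= b & f c = v.
Proof.
move=> ab fc fv.
have fc' : {within `[a, b], continuous f}.
  apply/subspace_continuousP => r /=; rewrite in_itv/= => rab.
  apply/cvgrPdist_lt => e e0; have [del del0 H] := fc r rab e e0.
  by rewrite near_withinE; exists del => //= s /= rs; rewrite in_itv/= => sab; exact: H.
have [|c + cv] := @IVT R f a b v ab fc'; last by rewrite in_itv/=; exists c.
by rewrite ge_min le_max; case: fv => /andP[-> ->]; rewrite ?orbT.
Qed.

Lemma locally_constant_in (P : R -> Prop) (a b r s : R) :
  (forall r : R, a < r < b -> exists2 e : R, 0 < e &
    forall s : R, a < s < b -> `|r - s| < e -> (P r <-> P s)) ->
  a < r < b -> a < s < b -> P r -> P s.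
Proof.
move=> loc rI sI; have [rs|/ltW sr] := leP r s.
  apply: locally_constant => // t tI; have [|e e0 H] := loc t; first by lra.
  by exists e => // u uI; apply: H; lra.
move=> Pr; apply: contrapT => nPs.
apply: (@locally_constant R (fun r => ~ P r) s r) Pr => //.
move=> t tI; have [|e e0 H] := loc t; first by lra.
exists e => // u uI tu; have [|H1 H2] := H u _ tu; first by lra.
by split=> ?; tauto.
Qed.

End real_paths.

Section simplicial.
Variables (R : realType) (T : metricType R) (S : simplicial_structure T).
Hypothesis hT : is_Rtree T.
Local Notation d := (@mdist R T).
Local Notation V := (ss_vertex S).
Local Notation K := (ss_complex S).
Local Notation c := (ss_coord S).
Implicit Types (x y : T) (u v w : V).

Let c_real x : realization K (c x).
Proof. by have [h _ _] := ss_bij S; exact: h. Qed.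

Lemma coord_inj x y : c x = c y -> x = y.
Proof. by have [_ h _] := ss_bij S; apply: h; rewrite inE. Qed.

Lemma coord_ge0 x v : 0 <= c x v.
Proof. by have [s _ []] := c_real x. Qed.

Lemma coord_cont x v (e : R) : 0 < e -> exists2 del : R, 0 < del &
  forall y, d x y < del -> `|c x v - c y v| < e.
Proof.
move=> e0; pose W := (fun a : {ptws V -> R} => a v) @^-1` (ball (c x v) e).
have oW : open W.
  apply: open_comp; last exact: ball_open.
  by move=> a _; exact: (@proj_continuous V (fun=> R : topologicalType) v).
have oU : open (c @^-1` W) by apply/(ss_top S); exists W.
have : nbhs x (c @^-1` W) by apply: open_nbhs_nbhs; split => //; exact: ballxx.
rewrite -metricType_numDomainType.filter_from_mdist_nbhs => -[del /= del0 H].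
by exists del => // y /H.
Qed.

(** The vertex of the tree with label [v]. *)
Lemma vertex_exists v : exists x, c x = (fun w => (w == v)%:R).
Proof.
have [_ _ h] := ss_bij S; have [|x _ xE] := h (fun w => (w == v)%:R); last by exists x.
exists [fset v]%fset; first exact: simplex1.
split=> [w|w|]; first by rewrite ler0n.
- by rewrite inE pnatr_eq0; case: (w == v).
- by rewrite big_seq_fset1 eqxx.
Qed.

Definition vpt v : T := projT1 (cid (vertex_exists v)).

Lemma vptE v w : c (vpt v) w = (w == v)%:R.
Proof. by rewrite /vpt; case: cid => x /= ->. Qed.

Lemma vpt_inj : injective vpt.
Proof.
move=> v w E; have := vptE v v; rewrite E vptE eqxx.
by case: eqP => // _ /esym/eqP; rewrite oner_eq0.
Qed.

Lemma vpt_vertex x v : c x v = 1 -> x = vpt v.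
Proof.
move=> x1; apply: coord_inj; apply/funext => w; rewrite vptE.
have [s _ [s0 sE s1]] := c_real x.
have vs : v \in s by rewrite -sE x1 oner_neq0.
case: eqP => [->//|/eqP wv].
apply/eqP/negPn/negP; rewrite sE => ws.
have wD : w \in (s `\ v)%fset by rewrite !inE wv.
have : c x w = 0.
  move: s1; rewrite (big_fsetD1 v vs) (big_fsetD1 w wD) /= x1.
  have : 0 <= \sum_(i <- ((s `\ v) `\ w)%fset) c x i by rewrite sumr_ge0.
  by have := s0 w; lra.
by move/eqP; rewrite -[_ == 0]negbK sE ws.
Qed.

(** [v] and [w] are the two vertices of a 1-simplex. *)
Definition edge v w := v <> w /\ K [fset v; w]%fset.

Lemma edge_sym v w : edge v w -> edge w v.
Proof. by rewrite /edge fsetUC => -[/nesym]. Qed.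

(** [x] lies on the closed edge [v, w]. *)
Definition on_edge v w x := forall u, u <> v -> u <> w -> c x u = 0.

Lemma on_edgeC v w x : on_edge v w x -> on_edge w v x.
Proof. by move=> h u uw uv; exact: h. Qed.

Lemma on_edge_sum v w x : v <> w -> on_edge v w x -> c x v + c x w = 1.
Proof.
move=> /eqP vw xE; have [s _ [_ sE <-]] := c_real x.
rewrite (@big_fset_incl _ _ _ _ s [fset v; w]%fset).
- by rewrite big_fsetU1 ?inE//= big_seq_fset1.
- apply/fsubsetP => u us; rewrite !inE; apply/negPn/negP; rewrite negb_or.
  move=> /andP[/eqP uv /eqP uw]; move: us; rewrite -sE.
  by rewrite xE ?eqxx.
- by move=> u _; rewrite -sE negbK => /eqP.
Qed.

Lemma vpt_on_edge v w : on_edge v w (vpt v).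
Proof. by move=> u /eqP/negPf uv _; rewrite vptE uv. Qed.

Lemma on_edge_inj v w x y : v <> w -> on_edge v w x -> on_edge v w y ->
  c x w = c y w -> x = y.
Proof.
move=> vw xE yE E; apply: coord_inj; apply/funext => u.
have [->//|uw] := pselect (u = w); have [->|uv] := pselect (u = v).
  by have := on_edge_sum vw xE; have := on_edge_sum vw yE; lra.
by rewrite xE ?yE.
Qed.

Let edge_path v w : edge v w -> exists g, iso_on 1 g /\
  forall x, on_edge v w x <-> exists2 r, 0 <= r <= 1 & g r = x.
Proof.
move=> [/eqP vw Kvw]; have [g gE gi] := ss_edge vw Kvw; exists g; split.
  by move=> s t sI tI; apply: gi; rewrite in_itv.
move=> x; split=> [xE|[r rI <-]].
  have : [set x | forall u, u \notin [fset v; w]%fset -> c x u = 0] x.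
    by move=> u; rewrite !inE negb_or => /andP[/eqP uv /eqP uw]; exact: xE.
  by rewrite -gE => -[r /= + <-]; rewrite in_itv/=; exists r.
have : [set g x | x in `[0, 1]] (g r) by exists r; rewrite //= in_itv.
rewrite gE => h u /eqP uv /eqP uw; apply: h.
by rewrite !inE negb_or uv.
Qed.

(** An isometric parametrization of an edge by [0, 1] sends no interior point
    to a vertex: the coordinate would take the same value on both sides. *)
Let edge_end v w g r : v <> w -> iso_on 1 g ->
  (forall x, on_edge v w x <-> exists2 r, 0 <= r <= 1 & g r = x) ->
  0 <= r <= 1 -> g r = vpt v -> r = 0 \/ r = 1.
Proof.
move=> vw gi gE rI gr; apply: contrapT => /not_orP[r0 r1].
have r0' : 0 < r by rewrite lt_neqAle eq_sym; move/eqP: r0; lra.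
have r1' : r < 1 by rewrite lt_neqAle; move/eqP: r1; lra.
pose p s := c (g s) w.
have pr : p r = 0 by rewrite /p gr vptE; case: eqP => // /esym.
have gon s : 0 <= s <= 1 -> on_edge v w (g s) by move=> sI; apply/gE; exists s.
have pinj s t : 0 <= s <= 1 -> 0 <= t <= 1 -> p s = p t -> s = t.
  move=> sI tI E; apply: (iso_on_inj gi) => //.
  exact: (on_edge_inj vw (gon _ sI) (gon _ tI) E).
have pc s : 0 <= s <= 1 -> forall e, 0 < e -> exists2 del, 0 < del &
    forall t, 0 <= t <= 1 -> `|s - t| < del -> `|p s - p t| < e.
  move=> sI e e0; have [del del0 H] := coord_cont (g s) w e0.
  by exists del => // t tI st; apply: H; rewrite gi.
have ppos s : 0 <= s <= 1 -> s <> r -> 0 < p s.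
  move=> sI sr; rewrite lt_neqAle coord_ge0 andbT eq_sym; apply/eqP => E.
  by apply: sr; apply: pinj => //; rewrite E pr.
have p0 : 0 < p 0 by apply: ppos; [lra|move=> E; move: r0'; lra].
have p1 : 0 < p 1 by apply: ppos; [lra|move=> E; move: r1'; lra].
pose m := Num.min (p 0) (p 1) / 2.
have m0 : 0 < m by rewrite divr_gt0// lt_min p0.
have [mp0 mp1] : m <= p 0 /\ m <= p 1.
  have : Num.min (p 0) (p 1) <= p 0 by rewrite ge_min lexx.
  have : Num.min (p 0) (p 1) <= p 1 by rewrite ge_min lexx orbT.
  by move: m0; rewrite /m; lra.
have [|||s sI ps] := @ivt_eps R p 0 r m; first by lra.
- move=> s sI e e0; have [|del del0 H] := pc s _ e e0; first by lra.
  by exists del => // t tI; apply: H; lra.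
- by right; rewrite pr; lra.
have [|||t tI pt] := @ivt_eps R p r 1 m; first by lra.
- move=> t tI e e0; have [|del del0 H] := pc t _ e e0; first by lra.
  by exists del => // u uI; apply: H; lra.
- by left; rewrite pr; lra.
have st : s = t by apply: pinj; rewrite ?ps ?pt//; lra.
by have sr : s = r by [lra]; move: ps m0; rewrite sr pr; lra.
Qed.

(** Edges can be parametrized from one given vertex to the other. *)
Lemma edge_param v w : edge v w -> exists g,
  [/\ iso_on 1 g, g 0 = vpt v, g 1 = vpt w &
   forall x, on_edge v w x <-> exists2 r, 0 <= r <= 1 & g r = x].
Proof.
move=> vwE; have [vw _] := vwE; have [g [gi gE]] := edge_path vwE.
have [r rI gr] : exists2 r, 0 <= r <= 1 & g r = vpt v.
  by apply/gE; exact: vpt_on_edge.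
have [s sI gs] : exists2 r, 0 <= r <= 1 & g r = vpt w.
  by apply/gE/on_edgeC; exact: vpt_on_edge.
have gE' x : on_edge w v x <-> exists2 r, 0 <= r <= 1 & g r = x.
  by rewrite -gE; split; exact: on_edgeC.
have rs : r <> s by move=> rs; move: gr; rewrite rs gs => /vpt_inj/esym.
have [r0|r1] := edge_end vw gi gE rI gr;
  have [s0|s1] := edge_end (nesym vw) gi gE' sI gs.
- by rewrite r0 s0 in rs.
- by exists g; split => //; [rewrite -r0|rewrite -s1].
- exists (fun t => g (1 - t)); split.
  + move=> t t' tI tI'; rewrite gi; [|lra|lra].
    by rewrite (_ : _ - _ = t' - t) 1?distrC//; ring.
  + by rewrite subr0 -r1.
  + by rewrite subrr -s0.
  + move=> x; rewrite gE; split=> -[t tI <-]; exists (1 - t) => //.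
    - by lra.
    - by congr g; ring.
    - by lra.
- by rewrite r1 s1 in rs.
Qed.

Lemma edge_dist v w : edge v w -> d (vpt v) (vpt w) = 1.
Proof.
by move=> /edge_param[g [gi <- <- _]]; rewrite (iso_onE gi); lra.
Qed.

(** A tree has no triangle, so the complex is one-dimensional. *)
Lemma no_triangle u v w : edge u v -> edge v w -> edge u w -> False.
Proof.
move=> uv vw uw; have := edge_dist uw.
have [f [fi f0 f1 fE]] := edge_param uv; have [g [gi g0 g1 gE]] := edge_param vw.
rewrite -f0 -g1 (Rtree_concat hT _ _ fi gi); [lra|lra|lra|by rewrite f1|].
move=> s t sI tI E; apply: (iso_on_inj fi) => //; first by lra.
rewrite f1; apply: vpt_vertex.
have fs : on_edge u v (f s) by apply/fE; exists s.
have ft : on_edge v w (f s) by apply/gE; exists t.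
have [[nuv _] [nuw _]] := (uv, uw).
have := on_edge_sum nuv fs; rewrite (ft u) //; lra.
Qed.

Lemma support_le2 x u v w : u <> v -> v <> w -> u <> w ->
  c x u <> 0 -> c x v <> 0 -> c x w <> 0 -> False.
Proof.
move=> uv vw uw xu xv xw; have [s Ks [_ sE _]] := c_real x.
have [us vs ws] : [/\ u \in s, v \in s & w \in s] by rewrite -!sE; split; apply/eqP.
have sub a b : a \in s -> b \in s -> a <> b -> edge a b.
  move=> as_ bs ab; split => //; apply: simplex_sub Ks.
    by apply/fsubsetP => t; rewrite !inE => /orP[] /eqP ->.
  by apply/fset0Pn; exists a; rewrite !inE eqxx.
by apply: (@no_triangle u v w); apply: sub.
Qed.

(** Every point is a vertex ([v = w]) or interior to an edge. *)
Lemma support_pair x : exists v w, [/\ c x v <> 0, c x w <> 0, on_edge v w x &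
  v <> w -> edge v w].
Proof.
have [s Ks [_ sE s1]] := c_real x.
have [v vs] : exists v, v \in s.
  apply/fset0Pn/negP => /eqP s0; move: s1.
  by rewrite s0 big_seq_fset0 => /esym/eqP; rewrite oner_eq0.
have xv : c x v <> 0 by apply/eqP; rewrite sE.
have [[w [vw xw]]|nw] := pselect (exists w, v <> w /\ c x w <> 0).
  exists v, w; split => //.
    move=> u uv uw; apply: contrapT => xu.
    by apply: (@support_le2 x u v w) => //; exact/nesym.
  have ws : w \in s by rewrite -sE; apply/eqP.
  move=> _; split => //; apply: simplex_sub Ks.
    by apply/fsubsetP => t; rewrite !inE => /orP[] /eqP ->.
  by apply/fset0Pn; exists v; rewrite !inE eqxx.
exists v, v; split => // u uv _; apply: contrapT => xu.
by apply: nw; exists u; split => //; exact/nesym.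
Qed.

(** A unit segment starting at a vertex runs along an edge. *)
Lemma edge_step v g : iso_on 1 g -> g 0 = vpt v -> exists w,
  [/\ edge v w, g 1 = vpt w &
      forall r, 0 < r < 1 -> c (g r) v <> 0 /\ c (g r) w <> 0].
Proof.
move=> gi g0.
have [del del0 H] := coord_cont (vpt v) v (ltr01 : 0 < 1 :> R).
(* close to [v], the segment is in the open star of [v] *)
pose r0 := Num.min del 1 / 2.
have r0I : 0 < r0 < 1 /\ r0 < del.
  have : Num.min del 1 <= del by rewrite ge_min lexx.
  have : Num.min del 1 <= 1 by rewrite ge_min lexx orbT.
  have : 0 < Num.min del 1 by rewrite lt_min del0 ltr01.
  by rewrite /r0 => ? ? ?; split; lra.
have dg r : 0 < r <= 1 -> d (vpt v) (g r) = r.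
  by move=> rI; rewrite -g0 (iso_onE gi); lra.
have xv : c (g r0) v <> 0.
  move=> E; have : d (vpt v) (g r0) < del by rewrite dg; lra.
  by move=> /H; rewrite vptE eqxx E subr0 normr1 ltxx.
have [w [vw xw]] : exists w, edge v w /\ c (g r0) w <> 0.
  have [a [b [xa xb ab abE]]] := support_pair (g r0).
  have [va|va] := pselect (v = a); last first.
    have [vb|vb] := pselect (v = b); last by case: xv; exact: ab.
    by exists a; rewrite vb; split => //; apply/edge_sym/abE => ba; apply: va; rewrite vb ba.
  exists b; rewrite va; split => //; apply: abE => Eab.
  have := dg r0; rewrite (_ : g r0 = vpt v) ?mdistxx; first lra.
  apply: vpt_vertex.
  have [s _ [_ sE <-]] := c_real (g r0).
  rewrite (@big_fset_incl _ _ _ _ s [fset v]%fset) ?big_seq_fset1//.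
    apply/fsubsetP => u; rewrite !inE -sE => /eqP xu; apply/eqP; apply: contrapT => uv.
    by apply: xu; apply: ab; rewrite -?Eab -?va.
  by move=> u _; rewrite -sE negbK => /eqP.
have [nvw _] := vw; exists w.
pose O r := c (g r) v <> 0 /\ c (g r) w <> 0.
have near_nz r u : 0 <= r <= 1 -> c (g r) u <> 0 ->
    exists2 e, 0 < e & forall s, 0 <= s <= 1 -> `|r - s| < e -> c (g s) u <> 0.
  move=> rI /eqP; rewrite -normr_gt0 => nz.
  have [e e0 He] := coord_cont (g r) u nz.
  exists e => // s sI rs E; have := He (g s); rewrite gi// E subr0 ltxx.
  by move=> /(_ rs).
have [h [hi h0 h1 hE]] := edge_param vw.
(* being interior to the edge [v, w] is locally constant along the segment: its
   points at time r are at distance r from [v], hence not vertices of the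
   edge *)
have OI r : 0 < r < 1 -> O r.
  move=> rI; apply: (@locally_constant_in R O 0 1 r0 r) => //; [|by case: r0I].
  move=> {}r {}rI; have [[rv rw]|nO] := pselect (O r).
    have [|e e0 He] := near_nz r v _ rv; first by lra.
    have [|e' e0' He'] := near_nz r w _ rw; first by lra.
    exists (Num.min e e'); first by rewrite lt_min e0.
    move=> s sI; rewrite lt_min => /andP[rs rs']; split=> // _; split.
      by apply: He => //; lra.
    by apply: He' => //; lra.
  have [[u [uv [uw xu]]]|nu] := pselect (exists u, u <> v /\ u <> w /\ c (g r) u <> 0).
    have [|e e0 He] := near_nz r u _ xu; first by lra.
    exists e => // s sI rs; split=> // -[sv sw].
    by case: (@support_le2 (g s) u v w) => //; apply: He => //; lra.
  have ron : on_edge v w (g r).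
    by move=> u uv uw; apply: contrapT => xu; apply: nu; exists u.
  have [rv|rv] := pselect (c (g r) v = 0).
    have := dg r; rewrite (_ : g r = vpt w) ?edge_dist//; first by lra.
    by apply: vpt_vertex; have := on_edge_sum nvw ron; rewrite rv; lra.
  have [rw|rw] := pselect (c (g r) w = 0); last by case: nO.
  have := dg r; rewrite (_ : g r = vpt v) ?mdistxx//; first by lra.
  by apply: vpt_vertex; have := on_edge_sum nvw ron; rewrite rw; lra.
split => //.
have on1 : on_edge v w (g 1).
  move=> u uv uw; apply: contrapT => xu.
  have [|e e0 He] := near_nz 1 u _ xu; first by lra.
  pose s := 1 - Num.min e 1 / 2.
  have sI : 0 < s < 1 /\ `|1 - s| < e.
    have : Num.min e 1 <= e by rewrite ge_min lexx.
    have : Num.min e 1 <= 1 by rewrite ge_min lexx orbT.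
    have : 0 < Num.min e 1 by rewrite lt_min e0 ltr01.
    by rewrite /s => ? ? ?; split; [lra|rewrite ger0_norm; lra].
  have [sv sw] := OI s sI.1.
  by case: (@support_le2 (g s) u v w) => //; apply: He; [lra|exact: sI.2].
have [t tI gt] := (hE (g 1)).1 on1.
have t1 : t = 1 by have := dg 1; rewrite -gt -h0 (iso_onE hi); lra.
by rewrite -gt t1.
Qed.

End simplicial.

(** * Trees described by a level space *)

Section level_trees.
Variables (R : realType) (E : lev_space).
Implicit Types F G H : E.

(** The height up to which [F] cut at [s] and [G] cut at [t] coincide. *)
Definition meet F (s : R) G (t : R) : R :=
  if `[< F = G >] then Num.min s t else Num.min (Num.min s t) (lev F G)%:R.

(** The rays [F] and [G] coincide up to height [r]. *)
Definition agree (r : R) F G := F = G \/ r <= (lev F G)%:R.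

Lemma le_meet F s G t r : (r <= meet F s G t) <-> [/\ r <= s, r <= t & agree r F G].
Proof.
rewrite /meet /agree; have [FG|FG] := pselect (F = G).
  by rewrite (asboolT FG) le_min; split=> [/andP[]|[-> ->]//]; split => //; left.
rewrite (asboolF FG) !le_min; split=> [/andP[/andP[? ?] ?]|[-> -> []]//].
by split => //; right.
Qed.

Lemma agree_sym r F G : agree r F G -> agree r G F.
Proof. by case=> [->|le]; [left|right; rewrite lev_sym]. Qed.

Lemma agree_trans r F G H : agree r F G -> agree r G H -> agree r F H.
Proof.
move=> FG GH; have [FH|FH] := pselect (F = H); first by left.
have [FG'|FG'] := pselect (F = G); first by rewrite FG'.
have [GH'|GH'] := pselect (G = H); first by rewrite -GH'.
right; case: FG => [//|FG]; case: GH => [//|GH].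
have [|le] := leP (lev F G) (lev G H).
  by move=> le; apply: (le_trans FG); rewrite ler_nat; apply: (lev_ultra_min FH _ le).
apply: (le_trans GH); rewrite ler_nat; apply: lev_ultra_min FH _ (leqnn _).
exact: ltnW.
Qed.

Lemma meet_sym F s G t : meet F s G t = meet G t F s.
Proof.
suff le F' s' G' t' : meet F' s' G' t' <= meet G' t' F' s'.
  by apply/le_anti; rewrite !le.
by have /le_meet[? ? /agree_sym ?] := lexx (meet F' s' G' t'); apply/le_meet.
Qed.

Lemma meet_ultra F s G t H u :
  Num.min (meet F s G t) (meet G t H u) <= meet F s H u.
Proof.
have /le_meet[m1 m2 FG] : Num.min (meet F s G t) (meet G t H u) <= meet F s G t.
  by rewrite ge_min lexx.
have /le_meet[m3 m4 GH] : Num.min (meet F s G t) (meet G t H u) <= meet G t H u.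
  by rewrite ge_min lexx orbT.
by apply/le_meet; split => //; exact: agree_trans GH.
Qed.

Lemma meet_diag F s t : meet F s F t = Num.min s t.
Proof. by rewrite /meet asboolT. Qed.

(** [pt F t] is the point at height [t >= 0] on the ray from the root to the
    end [F], and the distances are those of the tree of the level space. *)
Definition chart (T : metricType R) (pt : E -> R -> T) :=
  (forall x, exists F t, 0 <= t /\ pt F t = x) /\
  (forall F G s t, 0 <= s -> 0 <= t ->
     mdist (pt F s) (pt G t) = s + t - 2 * meet F s G t).

Section chart_theory.
Variables (T : metricType R) (pt : E -> R -> T).
Hypothesis hpt : chart pt.
Local Notation d := (@mdist R T).

Lemma chart_eq F s G t : 0 <= s -> 0 <= t ->
  (pt F s = pt G t) <-> s = t /\ agree s F G.
Proof.
move=> s0 t0; have := hpt.2 F G s t s0 t0.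
have /le_meet[m1 m2 ag] := lexx (meet F s G t) => dE; split=> [E'|[st FG]].
  move: dE; rewrite E' mdistxx => dE.
  have st : s = t by lra.
  by split => //; have <- : meet F s G t = s by lra.
subst t; have ms : s <= meet F s G s by apply/le_meet.
by apply: mdist_positivity; rewrite dE; lra.
Qed.

Lemma chart_dist F s t : 0 <= s -> 0 <= t -> d (pt F s) (pt F t) = `|s - t|.
Proof.
move=> s0 t0; rewrite hpt.2// meet_diag; have [st|ts] := leP s t.
  by rewrite distrC ger0_norm ?subr_ge0//; lra.
by rewrite ger0_norm ?subr_ge0 ?ltW//; lra.
Qed.

Lemma chart_root F G : pt F 0 = pt G 0.
Proof. by apply/chart_eq => //; split => //; right; rewrite ler0n. Qed.

Lemma chart_height F G t : 0 <= t -> d (pt F 0) (pt G t) = t.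
Proof. by move=> t0; rewrite (chart_root F G) chart_dist// sub0r normrN ger0_norm. Qed.

Lemma chart_gpr F s G t H : 0 <= s -> 0 <= t ->
  gpr (pt H 0) (pt F s) (pt G t) = meet F s G t.
Proof. by move=> s0 t0; rewrite /gpr !chart_height// hpt.2//; lra. Qed.

Lemma chart_tree_like : tree_like T.
Proof.
move=> p; have [F [_ _]] := hpt.1 p; move: p; apply: (tree_like_base (w := pt F 0)).
move=> x y z; have [Fx [s [s0 <-]]] := hpt.1 x.
have [Fy [t [t0 <-]]] := hpt.1 y; have [Fz [u [u0 <-]]] := hpt.1 z.
by rewrite !chart_gpr//; exact: meet_ultra.
Qed.

(** The geodesic from the point [s] of [F] to the point [t] of [G] goes down [F]
    to their branch point and up [G]. *)
Lemma chart_geodesic : geodesic T.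
Proof.
move=> x y; have [F [s [s0 <-]]] := hpt.1 x; have [G [t [t0 <-]]] := hpt.1 y.
set m := meet F s G t.
have m0 : 0 <= m by apply/le_meet; split => //; right; rewrite ler0n.
have /le_meet[ms mt ag] := lexx m.
have E' : pt F m = pt G m by apply/chart_eq.
pose g r := if r <= s - m then pt F (s - r) else pt G (r - s + 2 * m).
have cross r r' : 0 <= r <= s - m -> s - m <= r' <= s + t - 2 * m ->
    d (pt F (s - r)) (pt G (r' - s + 2 * m)) = r' - r.
  move=> rI rI'; rewrite hpt.2; [|lra|lra].
  suff -> : meet F (s - r) G (r' - s + 2 * m) = m by lra.
  apply/le_anti/andP; split; last by apply/le_meet; split => //; lra.
  have /le_meet[h1 h2 h3] := lexx (meet F (s - r) G (r' - s + 2 * m)).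
  by apply/le_meet; split => //; lra.
exists g; rewrite hpt.2// -/m; split.
- move=> r r' rI rI'; rewrite /g.
  have [rm|mr] := leP r (s - m); have [rm'|mr'] := leP r' (s - m).
  + rewrite chart_dist; [|lra|lra].
    by rewrite (_ : _ - _ = r' - r) 1?distrC//; ring.
  + by rewrite cross; [rewrite distrC ger0_norm; lra|lra|lra].
  + by rewrite metric_sym cross; [rewrite ger0_norm; lra|lra|lra].
  + rewrite chart_dist; [|lra|lra].
    by rewrite (_ : _ - _ = r - r')//; ring.
- by rewrite /g subr0 ifT//; lra.
- rewrite /g; case: ifPn => [le|_]; last by congr pt; ring.
  have tm : t = m by lra.
  by rewrite (_ : s - _ = m) -?tm//; [rewrite tm|lra].
Qed.

Lemma chart_Rtree : is_Rtree T.
Proof. by apply: tree_like_Rtree; [exact: chart_tree_like|exact: chart_geodesic]. Qed.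

End chart_theory.
End level_trees.

(** * The level space of a simplicial tree *)

Section ends_of_simplicial_trees.
Variables (R : realType) (X : rooted_Rtree R).
Hypothesis hX : in_Tge3 X.
Implicit Types (F G H : end_space X).
Local Notation d := (@mdist R X).

Let gc : geodesically_complete X. Proof. by case: hX. Qed.

Lemma point_on_ray x : exists F t, 0 <= t /\ ev F t = x.
Proof.
have nr y : y <> tree_root X -> exists F t, 0 <= t /\ ev F t = y.
  move=> yr; have [g [gi g0 g1]] := Rtree_geodesic (tree_Rtree (r := X)) (tree_root X) y.
  have l0 : 0 < d (tree_root X) y by rewrite mdist_gt0 eq_sym; apply/eqP.
  have [F FE] := ray_extend gc l0 g0 gi.
  exists F, (d (tree_root X) y); rewrite FE ?lexx ?ltW//.
have [->|] := pselect (x = tree_root X); last exact: nr.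
have [_ [S [_ vS]]] := hX.
have [y yr] : exists y, y <> tree_root X.
  have [v0 _] := support_pair S (tree_Rtree (r := X)) (tree_root X).
  have /card3P[a [b [_ [_ [ab _ _]]]]] := vS v0.
  have [E|] := pselect (vpt a = tree_root X); last by exists (vpt a).
  by exists (vpt b) => E'; apply: ab; apply: vpt_inj; rewrite E.
by have [F _] := nr _ yr; exists F, 0; rewrite ev0.
Qed.

Section with_structure.
Variable S : simplicial_structure X.
Hypothesis rS : is_vertex S (tree_root X).

Let step F n (v : ss_vertex S) : ev F n%:R = vpt v -> exists w, [/\ edge v w,
  ev F n.+1%:R = vpt w &
  forall r, n%:R < r < n.+1%:R -> ss_coord S (ev F r) v <> 0 /\ ss_coord S (ev F r) w <> 0].
Proof.
move=> Fv; have [||w [vw w1 wr]] := @edge_step R X S (tree_Rtree (r := X)) v (fun r => ev F (n%:R + r)).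
- move=> s t sI tI; rewrite ev_dist; [|by rewrite addr_ge0//; lra..].
  by rewrite (_ : _ - _ = s - t)//; ring.
- by rewrite addr0.
exists w; split => //; first by rewrite -natr1.
move=> r; rewrite -natr1 => rI; have := wr (r - n%:R).
by rewrite (_ : n%:R + _ = r); [apply; lra|ring].
Qed.

(** Rays meet a vertex at each integer height. *)
Lemma ev_vertex F n : exists v : ss_vertex S, ev F n%:R = vpt v.
Proof.
elim: n => [|n [v /step[w [_ -> _]]]]; last by exists w.
by have [v /vpt_vertex] := rS; rewrite -(ev0 F); exists v.
Qed.

(** Rays that coincide beyond height [n] run through the same edge above this
    height. *)
Lemma ev_agree_succ F G n r : n%:R < r -> ev F r = ev G r ->
  ev F n.+1%:R = ev G n.+1%:R.
Proof.
move=> nr FGr; have [le|lt] := leP n.+1%:R r; first exact: ev_agree_le FGr.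
have [v Fv] := ev_vertex F n; have [w [[vw _] Fw Fr]] := step Fv.
have Gv : ev G n%:R = vpt v.
  by rewrite -Fv; apply/esym/(ev_agree_le _ (ltW nr) FGr).
have [w' [[vw' _] Gw' Gr]] := step Gv.
have [|F1 F2] := Fr r; first by rewrite nr.
have [|G1 G2] := Gr r; first by rewrite nr.
rewrite Fw Gw'; congr vpt; apply: contrapT => ww'.
apply: (@support_le2 R X S (tree_Rtree (r := X)) (ev F r) v w w') => //.
by rewrite FGr.
Qed.

Lemma ends_separate F G : F <> G ->
  exists n : nat, forall u : R, 0 <= u -> ev F u = ev G u <-> u <= n%:R.
Proof.
move=> FG; have [t t0 FGt] : exists2 t : R, 0 <= t & ev F t <> ev G t.
  apply: contrapT => /forall2NP h; apply: FG; apply: ev_ext => t t0.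
  by apply: contrapT => ne; case: (h t).
pose P n := `[< ev F n%:R <> ev G n%:R >].
have exP : exists n, P n.
  exists (Num.truncn t).+1; apply/asboolP => E; apply: FGt.
  by apply: ev_agree_le E => //; rewrite ltW// truncnS_gt.
have [n /asboolP Pn nmin] := ex_minnP exP.
case: n Pn nmin => [|n] Pn nmin; first by case: Pn; rewrite !ev0.
exists n => u u0; split=> [E|un].
  rewrite leNgt; apply/negP => nu; apply: Pn; exact: ev_agree_succ E.
apply: ev_agree_le u0 un _; apply: contrapT => ne.
by have := nmin n (asboolT ne); rewrite ltnn.
Qed.

End with_structure.

Let sep F G : exists n : nat, F <> G ->
  forall u : R, 0 <= u -> ev F u = ev G u <-> u <= n%:R.
Proof.
have [FG|FG] := pselect (F = G); first by exists 0%N.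
have [_ [S [rS _]]] := hX; have [n nE] := ends_separate rS FG.
by exists n.
Qed.

(** The height at which two distinct ends separate; its value on equal ends is
    arbitrary. *)
Definition elev F G : nat := projT1 (cid (sep F G)).

Lemma elevP F G : F <> G ->
  forall u : R, 0 <= u -> ev F u = ev G u <-> u <= (elev F G)%:R.
Proof. by rewrite /elev; case: cid. Qed.

Lemma ev_agree F G u : 0 <= u ->
  ev F u = ev G u <-> F = G \/ u <= (elev F G)%:R.
Proof.
move=> u0; have [->|FG] := pselect (F = G); first by split=> // _; left.
by rewrite (elevP FG u0); split=> [|[]//]; right.
Qed.

Let elev_sym F G : elev F G = elev G F.
Proof.
have [->//|FG] := pselect (F = G).
suff le F' G' : F' <> G' -> (elev F' G' <= elev G' F')%N.
  by apply/eqP; rewrite eqn_leq !le//; exact: nesym.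
move=> FG'; rewrite -(ler_nat R); apply/(elevP (nesym FG')) => //.
by apply/esym/(elevP FG').
Qed.

Let elev_ultra n F G H : F = G \/ (n <= elev F G)%N ->
  G = H \/ (n <= elev G H)%N -> F = H \/ (n <= elev F H)%N.
Proof. by rewrite -!(ler_nat R) -!ev_agree//; exact: etrans. Qed.

Let tripod F G s t : F <> G -> 0 <= s -> 0 <= t ->
  d (ev F s) (ev G t) = s + t - 2 * Num.min (Num.min s t) (elev F G)%:R.
Proof. by move=> FG; apply: ev_tripod => //; exact: elevP. Qed.

(** A third neighbour of the vertex at height [n] on [F] lies on a ray that
    leaves [F] at this vertex. *)
Let elev_sphere F n : exists2 G, F <> G & elev F G = n.
Proof.
have [_ [S [rS vS]]] := hX.
have [v Fv] := ev_vertex rS F n; have [w Fw] := ev_vertex rS F n.+1.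
have [w' Fw'] := ev_vertex rS F n.-1.
(* [w] is the next vertex on [F] and [w'] the previous one *)
have [u [vu uw uw']] : exists u, [/\ edge v u, u <> w & u <> w'].
  have /card3P[a [b [c [[[/eqP va Ka] [/eqP vb Kb] [/eqP vc Kc]] [ab ac bc]]]]] := vS v.
  have [aw|aw] := pselect (a = w); have [aw'|aw'] := pselect (a = w').
  - by exists b; split => //; rewrite -?aw -?aw'; exact: nesym.
  - have [bw'|bw'] := pselect (b = w').
      by exists c; split => //; rewrite -?aw -?bw'; exact: nesym.
    by exists b; split => //; rewrite -aw; exact: nesym.
  - have [bw'|bw'] := pselect (b = w).
      by exists c; split => //; rewrite -?aw' -?bw'; exact: nesym.
    by exists b; split => //; rewrite -aw'; exact: nesym.
  - by exists a.
have [G [t [t0 Gt]]] := point_on_ray (vpt u).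
have dGt : d (ev F n%:R) (ev G t) = 1.
  by rewrite Fv Gt; apply: edge_dist => //; exact: tree_Rtree.
have nup : t = n%:R + 1 -> ev F t <> ev G t.
  by move=> tn; rewrite Gt tn natr1 Fw => /vpt_inj; exact: nesym.
have ndown : t = n%:R - 1 -> ev F t <> ev G t.
  move=> tn; rewrite Gt; case: n tn Fw' {Fv Fw dGt nup} => [|n] tn Fw'.
    by move: t0; rewrite tn sub0r oppr_ge0 ler10.
  by rewrite tn -natr1 addrK Fw' => /vpt_inj; exact: nesym.
have FG : F <> G.
  move=> FG; rewrite -FG ev_dist// in dGt.
  have [nt|tn] := leP n%:R t.
    by apply: nup; [move: dGt; rewrite distrC ger0_norm ?subr_ge0//; lra|rewrite FG].
  by apply: ndown; [move: dGt; rewrite ger0_norm ?subr_ge0 ?ltW//; lra|rewrite FG].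
exists G => //; have lE := elevP FG; rewrite tripod// in dGt.
apply/eqP; rewrite -(eqr_nat R).
have [mn|nm] := ltnP (elev F G) n.
  have mn' : (elev F G)%:R + 1 <= n%:R :> R by rewrite natr1 ler_nat.
  have [tm|mt] := leP t (elev F G)%:R.
    have FGt : ev F t = ev G t by apply/lE.
    case: ndown => //; move: dGt; rewrite (min_r (y := t)); last by lra.
    by rewrite min_l//; lra.
  by move: dGt; rewrite min_r; [lra|rewrite le_min; apply/andP; split; lra].
have nm' : n%:R <= (elev F G)%:R :> R by rewrite ler_nat.
have [nt|tn] := leP n%:R t.
  move: dGt; rewrite (min_l nt) min_l// => dGt.
  have tn : t = n%:R + 1 by lra.
  move: nm; rewrite leq_eqVlt => /orP[/eqP ->//|nm].
  by case: nup => //; apply/lE => //; rewrite tn natr1 ler_nat.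
case: ndown; first by move: dGt; rewrite (min_r (ltW tn)) min_l; lra.
by apply/lE => //; lra.
Qed.

(** The end space of a simplicial tree as a level space. *)
Definition end_lev : lev_space := LevSpace elev_sym elev_ultra elev_sphere.

Lemma end_chart : @chart R end_lev X (@ev R X).
Proof.
split=> [|F G s t s0 t0]; first exact: point_on_ray.
rewrite /meet; have [FG|FG] := pselect (F = G).
  rewrite (asboolT FG) FG ev_dist//; have [st|ts] := leP s t.
    by rewrite distrC ger0_norm ?subr_ge0//; lra.
  by rewrite ger0_norm ?subr_ge0 ?ltW//; lra.
by rewrite (asboolF FG) tripod.
Qed.

End ends_of_simplicial_trees.

(** * Distortion in terms of levels *)

(** With the convention [0^-1 = +oo], the ratio of the supremum to the infimum of
    a family of positive reals compares its members pairwise. *)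
Lemma ereal_ratio_le (R : realType) (U : Type) (A : set U) (h : U -> R) (K : R) :
  A !=set0 -> 0 < K -> (forall x, A x -> 0 < h x) ->
  ((ereal_sup [set (h x)%:E | x in A] / ereal_inf [set (h x)%:E | x in A] <= K%:E)%E
   <-> forall x y, A x -> A y -> h x <= K * h y).
Proof.
move=> [x0 Ax0] K0 hpos; set D := [set (h x)%:E | x in A].
have supD x : A x -> ((h x)%:E <= ereal_sup D)%E.
  by move=> Ax; apply: ereal_sup_ubound; exists x.
have infD x : A x -> (ereal_inf D <= (h x)%:E)%E.
  by move=> Ax; apply: ereal_inf_lbound; exists x.
have inf0 : (0 <= ereal_inf D)%E.
  by apply/ereal_infP => _ [x Ax <-]; rewrite lee_fin ltW ?hpos.
split=> [+ x y Ax Ay|hK].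
  move: (supD x Ax) (infD y Ay) inf0.
  case: (ereal_inf D) => [i| |]; rewrite ?leey ?leeNy_eq ?leye_eq//.
  case: (ereal_sup D) => [s| |]; rewrite ?lee_fin ?leeNy_eq//.
    move=> hs ih; rewrite le_eqVlt => /orP[/eqP <-|i0].
      rewrite inve0 gt0_muley ?lte_fin; last exact: lt_le_trans (hpos x Ax) hs.
      by rewrite leye_eq.
    rewrite inver gt_eqF// -EFinM lee_fin ler_pdivrMr// => sK.
    apply: (le_trans hs); apply: (le_trans sK).
    by rewrite ler_pM2l.
  move=> _ ih; rewrite le_eqVlt => /orP[/eqP <-|i0].
    by rewrite inve0 gt0_muley ?ltry// leye_eq.
  by rewrite inver gt_eqF// gt0_mulye ?lte_fin ?invr_gt0// leye_eq.
have supK y : A y -> (ereal_sup D <= (K * h y)%:E)%E.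
  by move=> Ay; apply/ereal_supP => _ [x Ax <-]; rewrite lee_fin hK.
have [s sE] : exists s, ereal_sup D = s%:E.
  move: (supD _ Ax0) (supK _ Ax0).
  by case: (ereal_sup D) => [s| |]; rewrite ?leeNy_eq ?leye_eq//; exists s.
have s0 : 0 < s.
  by have := supD _ Ax0; rewrite sE lee_fin; apply: lt_le_trans; exact: hpos.
have infK : ((s / K)%:E <= ereal_inf D)%E.
  apply/ereal_infP => _ [y Ay <-].
  by rewrite lee_fin ler_pdivrMr// mulrC -lee_fin -sE supK.
have [i iE] : exists i, ereal_inf D = i%:E.
  move: (infD _ Ax0) inf0.
  by case: (ereal_inf D) => [s'| |]; rewrite ?leeNy_eq ?leye_eq//; exists s'.
move: infK; rewrite iE lee_fin sE => sKi.
have i0 : 0 < i by apply: lt_le_trans sKi; rewrite divr_gt0.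
by rewrite inver gt_eqF// -EFinM lee_fin ler_pdivrMr// mulrC -ler_pdivrMr.
Qed.

Section end_distance.
Variables (R : realType) (X : rooted_Rtree R).
Hypothesis hX : in_Tge3 X.
Implicit Types F G : end_space X.

Lemma end_mdist F G : F <> G -> mdist F G = expR (- (elev hX F G)%:R).
Proof.
move=> FG; rewrite /mdist /= /end_dist.
suff -> : end_gprod F G = (elev hX F G)%:R%:E by [].
apply/le_anti/andP; split.
  apply/ereal_supP => _ [t /= FGt <-]; rewrite lee_fin.
  by apply/(elevP hX FG) => //; rewrite -!evE.
apply: ereal_sup_ubound; exists (elev hX F G)%:R%:nng => //=.
by rewrite !evE; apply/(elevP hX FG) => //=.
Qed.

Lemma end_mdist_eq F0 F F' : F0 <> F -> F0 <> F' ->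
  mdist F0 F = mdist F0 F' <-> elev hX F0 F = elev hX F0 F'.
Proof.
move=> n1 n2; rewrite !end_mdist//; split=> [/expR_inj/oppr_inj/eqP|->//].
by rewrite eqr_nat => /eqP.
Qed.

Lemma end_inhabited : exists F : end_space X, True.
Proof. by have [F _] := point_on_ray hX (tree_root X); exists F. Qed.

End end_distance.

Section distortion_levels.
Variables (R : realType) (X Y : rooted_Rtree R).
Hypotheses (hX : in_Tge3 X) (hY : in_Tge3 Y).
Implicit Types (f : end_space X -> end_space Y).
Local Notation levb := (@lev_bounded (end_lev hX) (end_lev hY)).

Let supP f (M : \bar R) : (sup_distortion f <= M)%E <->
  forall F e, 0 < e -> (distortion f F e <= M)%E.
Proof.
split=> [/ereal_supP h F e e0|h].
  have /ereal_supP := h _ (ex_intro2 _ _ F I erefl).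
  by apply; exists e.
by apply/ereal_supP => _ [F _ <-]; apply/ereal_supP => _ [e e0 <-]; exact: h.
Qed.

Let distP f F0 F (K : R) : injective f -> F0 <> F -> 0 < K ->
  (distortion f F0 (mdist F0 F) <= K%:E)%E <->
  forall G G', F0 <> G -> F0 <> G' -> elev hX F0 G = elev hX F0 F ->
    elev hX F0 G' = elev hX F0 F ->
    mdist (f F0) (f G) <= K * mdist (f F0) (f G').
Proof.
move=> finj nF K0; rewrite /distortion ifF; last first.
  by apply/negbTE/set0P; exists F.
set e := mdist F0 F.
have e0 : 0 < e by rewrite mdist_gt0; apply/eqP.
have neq G : mdist F0 G = e -> F0 <> G.
  by move=> dG E; move: e0; rewrite -dG E mdistxx ltxx.
pose h G := mdist (f F0) (f G).
have hpos G : mdist F0 G = e -> 0 < h G.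
  by move=> /neq nG; rewrite mdist_gt0; apply/eqP => /finj.
have ne : [set G | mdist F0 G = e] !=set0 by exists F.
rewrite (ereal_ratio_le ne K0 hpos); split=> H G G'.
  move=> nG nG' eG eG'; apply: H => /=.
    by apply/(end_mdist_eq hX nG nF).
  by apply/(end_mdist_eq hX nG' nF).
move=> /= dG dG'; apply: H; try exact: neq.
  by apply/(end_mdist_eq hX (neq _ dG) nF).
by apply/(end_mdist_eq hX (neq _ dG') nF).
Qed.

(** Finite distortions are powers of [e]; the lower bound on [K] comes from the fact
    that no sphere of integral level is empty. *)
Lemma sup_distortion_le f (K : R) : injective f ->
  (sup_distortion f <= K%:E)%E <-> 1 <= K /\ levb (Num.truncn (ln K)) f.
Proof.
move=> finj; have fneq F G : F <> G -> f F <> f G by move=> FG /finj.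
rewrite supP; split=> [fK|[K1 fb] F e e0].
  have K1 : 1 <= K.
    rewrite leNgt; apply/negP => lt1; have [F0 _] := end_inhabited hX.
    have [F nF _] := lev_sphere (F0 : end_lev hX) 0.
    (* a positive constant less than 1 would also bound the distortion *)
    pose K' := Num.max K (1 / 2).
    have K'0 : 0 < K' by rewrite lt_max; apply/orP; right; lra.
    have K'1 : K' < 1 by rewrite gt_max lt1 /=; lra.
    have KK' : (distortion f F0 (mdist F0 F) <= K'%:E)%E.
      apply: (le_trans (fK F0 _ _)); first by rewrite mdist_gt0; apply/eqP.
      by rewrite lee_fin le_max lexx.
    have := (distP finj nF K'0).1 KK' F F nF nF erefl erefl.
    have : 0 < mdist (f F0) (f F) by rewrite mdist_gt0; apply/eqP/fneq.
    by nra.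
  split => // F0 F F' nF nF' eF.
  have K0 : 0 < K by lra.
  have [|lt] := leqP (lev (f F0 : end_lev hY) (f F)) (lev (f F0 : end_lev hY) (f F')).
    by move=> le; apply: (leq_trans le); rewrite leq_addr.
  rewrite -leq_subLR truncn_ge_nat ?ln_ge0// -ler_expR lnK ?posrE//.
  have := (distP finj nF K0).1 (fK F0 _ _) F' F nF' nF (esym eF) erefl.
  rewrite mdist_gt0 => /(_ (introN eqP nF)).
  rewrite !(end_mdist hY); [|exact: fneq..].
  rewrite -ler_pdivrMr ?expR_gt0// -expRN -expRD opprK.
  apply: le_trans; rewrite ler_expR natrB; last exact: ltnW.
  by rewrite [X in _ <= X]addrC.
have K0 : 0 < K by lra.
have [S0|/set0P[G /= dG]] := eqVneq [set x | mdist F x = e] set0.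
  by rewrite /distortion S0 eqxx lee_fin.
have nG : F <> G by move=> FG; move: e0; rewrite -dG FG mdistxx ltxx.
rewrite -dG; apply/(distP finj nG K0) => G1 G2 n1 n2 e1 e2.
rewrite !(end_mdist hY); [|exact: fneq..].
rewrite -ler_pdivrMr ?expR_gt0// -expRN -expRD opprK.
have le2 : (lev (f F : end_lev hY) (f G2) <= lev (f F : end_lev hY) (f G1) +
    Num.truncn (ln K))%N by apply: fb => //; rewrite /= e1.
have -> : K = expR (ln K) by rewrite lnK.
rewrite ler_expR addrC lerBlDl.
have le3 : (Num.truncn (ln K))%:R <= ln K by rewrite truncn_le ln_ge0.
by move: le2; rewrite -(ler_nat R) natrD /= => le2; lra.
Qed.

(** Continuity comes for free: a surjection of bounded distortion maps small
    balls to small balls. *)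
Lemma lev_bounded_continuous k f : injective f ->
  (forall G, exists F, f F = G) -> levb k f -> continuous f.
Proof.
move=> finj fsurj fb F0.
apply: (@metricType_numDomainType.cvgrPdist_lt _ _ _ (nbhs F0) _ _ _).2 => e e0.
pose N := (Num.truncn (- ln e)).+1.
have Ne : expR (- N%:R) < e.
  by rewrite -[X in _ < X]lnK ?posrE// ltr_expR ltrNl truncnS_gt.
have [M HM] := lev_bounded_cont (finj : @injective (end_lev hY) (end_lev hX) f) fb fsurj F0 N.
rewrite -metricType_numDomainType.filter_from_mdist_nbhs.
exists (expR (- M%:R)); first exact: expR_gt0.
move=> F /= dF; have [<-|nF] := pselect (F0 = F); first by rewrite mdistxx.
apply: le_lt_trans Ne; rewrite (end_mdist hY); last by move/finj.
rewrite ler_expR lerN2 ler_nat; apply: HM => //.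
move: dF; rewrite (end_mdist hX)// ltr_expR ltrN2 ltr_nat.
exact: ltnW.
Qed.

End distortion_levels.

Section varrho_levels.
Variables (R : realType) (X Y : rooted_Rtree R).
Hypotheses (hX : in_Tge3 X) (hY : in_Tge3 Y).
Local Notation equiv := (@lev_equiv (end_lev hX) (end_lev hY)).

(** An admissible constant can be lowered to a power of [e]. *)
Lemma distortion_boundsP (K : R) : distortion_bounds X Y K <->
  1 <= K /\ equiv (Num.truncn (ln K)).
Proof.
split=> [[f [g [[fg gf _ _] fK gK]]]|[K1 [f [g [fg gf bf bg]]]]].
  have [K1 bf] := (sup_distortion_le hX hY K (can_inj fg)).1 fK.
  have [_ bg] := (sup_distortion_le hY hX K (can_inj gf)).1 gK.
  by split => //; exists f, g.
exists f, g; split.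
- split => //.
    by apply: (lev_bounded_continuous (can_inj fg) _ bf) => G; exists (g G).
  by apply: (lev_bounded_continuous (can_inj gf) _ bg) => G; exists (f G).
- by apply/(sup_distortion_le hX hY _ (can_inj fg)).
- by apply/(sup_distortion_le hY hX _ (can_inj gf)).
Qed.

(** The infimum that defines [varrho] is attained, at the least exponent of a
    bounded distortion equivalence. *)
Lemma varrho_levels k0 : equiv k0 -> exists k,
  [/\ equiv k, forall j, equiv j -> (k <= j)%N &
      varrho X Y = ln (1 + 2 * k%:R)].
Proof.
move=> e0; have ex : exists k, `[< equiv k >] by exists k0; apply/asboolP.
have [k /asboolP ek kmin] := ex_minnP ex.
exists k; split => //; first by move=> j ej; apply: kmin; apply/asboolP.
suff -> : varrho X Y = ln (1 + 2 * ln (expR k%:R)) by rewrite expRK.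
rewrite /varrho /dist_const; congr (ln (1 + 2 * ln _)).
have bk : distortion_bounds X Y (expR k%:R).
  apply/distortion_boundsP; split; first by rewrite -[X in X <= _]expR0 ler_expR ler0n.
  by rewrite expRK natrK.
have lb : lbound (distortion_bounds X Y) (expR k%:R).
  move=> K /distortion_boundsP[K1 eK].
  rewrite -[X in _ <= X]lnK; last by rewrite posrE; lra.
  rewrite ler_expR -truncn_ge_nat ?ln_ge0//.
  by apply: kmin; apply/asboolP.
apply/le_anti/andP; split; first by apply: ge_inf => //; exists (expR k%:R).
by apply: lb_le_inf => //; exists (expR k%:R).
Qed.

End varrho_levels.

(** * Rooted isometries *)

(** A bijection preserving the levels extends to the trees: the point at height
    [t] on the ray [F] is sent to the point at height [t] on the ray [f F]. *)
Lemma chart_isometry (R : realType) (E E' : lev_space) (T T' : metricType R)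
    (pt : E -> R -> T) (pt' : E' -> R -> T') (f : E -> E') (g : E' -> E) :
  chart pt -> chart pt' -> cancel f g -> cancel g f ->
  (forall F G, F <> G -> lev (f F) (f G) = lev F G) ->
  exists h : T -> T', [/\ bijective h,
    forall x y, mdist (h x) (h y) = mdist x y &
    forall F t, 0 <= t -> h (pt F t) = pt' (f F) t].
Proof.
move=> c c' fg gf lf.
have lg F G : F <> G -> lev (g F) (g G) = lev F G.
  by move=> n; rewrite -lf ?gf// => /(can_inj gf).
have fwd (A B : lev_space) (S S' : metricType R) (p : A -> R -> S)
    (p' : B -> R -> S') (k : A -> B) : chart p -> chart p' ->
    (forall F G, F <> G -> lev (k F) (k G) = lev F G) ->
    exists h : S -> S', forall F t, 0 <= t -> h (p F t) = p' (k F) t.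
  move=> cp cp' kl; have /choice[h hE] : forall x, exists y, forall F t, 0 <= t ->
      x = p F t -> y = p' (k F) t.
    move=> x; have [F [t [t0 <-]]] := cp.1 x; exists (p' (k F) t) => G s s0.
    move=> /(chart_eq cp)[] // ts ag; apply/(chart_eq cp') => //; split => //.
    have [->|FG] := pselect (F = G); first by left.
    by right; rewrite kl//; case: ag.
  by exists h => F t t0; exact: hE.
have [h hE] := fwd _ _ _ _ _ _ f c c' lf.
have [h' hE'] := fwd _ _ _ _ _ _ g c' c lg.
exists h; split => //.
  exists h' => x.
    by have [F [t [t0 <-]]] := c.1 x; rewrite hE// hE'// fg.
  by have [F [t [t0 <-]]] := c'.1 x; rewrite hE'// hE// gf.
move=> x y; have [F [s [s0 <-]]] := c.1 x; have [G [t [t0 <-]]] := c.1 y.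
rewrite !hE// c.2// c'.2//; congr (_ + _ - 2 * _); rewrite /meet.
have [->|FG] := pselect (F = G); first by rewrite !asboolT.
by rewrite !asboolF// ?lf// => /(can_inj fg).
Qed.

Section isometry_ends.
Variables (R : realType) (X Y : rooted_Rtree R).
Hypotheses (hX : in_Tge3 X) (hY : in_Tge3 Y).

Lemma lev_equiv0_rooted_isometric :
  @lev_equiv (end_lev hX) (end_lev hY) 0 -> rooted_isometric X Y.
Proof.
move=> [f [g [fg gf bf bg]]].
have lf F G : F <> G -> lev (f F) (f G) = lev F G.
  exact: (lev_equiv0_isometric fg gf bf bg).
have [h [hb hd hE]] := chart_isometry (end_chart hX) (end_chart hY) fg gf lf.
exists h; split => //; have [F _] := end_inhabited hX.
by rewrite -(ev0 F) hE// ev0.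
Qed.

Lemma isometry_on_ends (h : X -> Y) : (forall x y, mdist (h x) (h y) = mdist x y) ->
  h (tree_root X) = tree_root Y ->
  exists2 f : end_space X -> end_space Y,
    forall F t, f F t = h (F t) & forall F G, F <> G -> elev hY (f F) (f G) = elev hX F G.
Proof.
move=> hd hr.
have hi : injective h by move=> x y E; apply: mdist_positivity; rewrite -hd E mdistxx.
have iso (F : end_space X) : ray_isometry (fun t => h (F t)).
  by move=> s t; rewrite hd; exact: end_isom.
have rt (F : end_space X) : h (F 0%:nng) = tree_root Y by rewrite end_root.
exists (fun F => EndSpace (iso F) (rt F)) => // F G FG.
have fFG : EndSpace (iso F) (rt F) <> EndSpace (iso G) (rt G).
  move=> E; apply: FG; apply: end_spaceP => t; apply: hi.
  exact: (congr1 (fun A : end_space Y => A t) E).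
have eqv (u : R) : 0 <= u -> (u <= (elev hY (EndSpace (iso F) (rt F)) (EndSpace (iso G) (rt G)))%:R) <->
    (u <= (elev hX F G)%:R).
  move=> u0; rewrite -(elevP hX FG u0) -(elevP hY fFG u0) /ev /=.
  by split=> [/hi|->].
by apply/eqP; rewrite -(eqr_nat R) eq_le; apply/andP; split; apply/eqv.
Qed.

End isometry_ends.

Lemma rooted_isometric_lev_equiv0 (R : realType) (X Y : rooted_Rtree R)
    (hX : in_Tge3 X) (hY : in_Tge3 Y) :
  rooted_isometric X Y -> @lev_equiv (end_lev hX) (end_lev hY) 0.
Proof.
move=> [h [[h' hh' h'h] hd hr]].
have hd' x y : mdist (h' x) (h' y) = mdist x y by rewrite -hd !h'h.
have hr' : h' (tree_root Y) = tree_root X by rewrite -hr hh'.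
have [f fE lf] := isometry_on_ends hX hY hd hr.
have [g gE lg] := isometry_on_ends hY hX hd' hr'.
exists f, g; split.
- by move=> F; apply: end_spaceP => t; rewrite gE fE hh'.
- by move=> F; apply: end_spaceP => t; rewrite fE gE h'h.
- by move=> F0 F F' n1 n2 e; rewrite /= !lf// addn0; move: e => /= ->.
- by move=> F0 F F' n1 n2 e; rewrite /= !lg// addn0; move: e => /= ->.
Qed.

Section varrho_metric.
Variables (R : realType).
Implicit Types X Y Z : rooted_Rtree R.

(** [X] and [Y] are complete simplicial trees of valence at least three whose end
    spaces are bounded distortion equivalent. *)
Definition bd_equiv X Y := exists (hX : in_Tge3 X) (hY : in_Tge3 Y) k,
  @lev_equiv (end_lev hX) (end_lev hY) k.

Lemma bd_equiv_sym X Y : bd_equiv X Y -> bd_equiv Y X.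
Proof. by move=> [hX [hY [k /lev_equiv_sym e]]]; exists hY, hX, k. Qed.

Lemma bd_equiv_trans X Y Z : bd_equiv X Y -> bd_equiv Y Z -> bd_equiv X Z.
Proof.
move=> [hX [hY [k e]]] [hY' [hZ [j e']]].
rewrite (Prop_irrelevance hY' hY) in e'.
by exists hX, hZ; eexists; exact: lev_equiv_comp e e'.
Qed.

Lemma varrho_ge0 X Y : bd_equiv X Y -> 0 <= varrho X Y.
Proof.
move=> [hX [hY [k0 e]]]; have [k [_ _ ->]] := varrho_levels e.
by rewrite ln_ge0// lerDl mulr_ge0.
Qed.

Lemma varrho_eq0 X Y : bd_equiv X Y -> varrho X Y = 0 <-> rooted_isometric X Y.
Proof.
move=> [hX [hY [k0 e]]]; have [k [ek kmin ->]] := varrho_levels e.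
have pos : 0 < 1 + 2 * k%:R :> R by rewrite ltr_wpDr// mulr_ge0.
split=> [h|/(rooted_isometric_lev_equiv0 hX hY) /kmin].
  apply: (lev_equiv0_rooted_isometric (hX := hX) (hY := hY)).
  have : 1 + 2 * k%:R = 1 :> R by rewrite -[LHS]lnK ?posrE// h expR0.
  move=> h1; have : k%:R = 0 :> R by lra.
  by move=> /eqP; rewrite pnatr_eq0 => /eqP k00; rewrite k00 in ek.
by rewrite leqn0 => /eqP ->; rewrite mulr0 addr0 ln1.
Qed.

Lemma varrho_sym X Y : varrho X Y = varrho Y X.
Proof.
rewrite /varrho /dist_const; suff -> : distortion_bounds X Y = distortion_bounds Y X by [].
by apply/seteqP; split=> K [f [g [[fg gf fc gc] fK gK]]]; exists g, f; split.
Qed.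

Lemma varrho_triangle X Y Z : bd_equiv X Y -> bd_equiv Y Z ->
  varrho X Z <= varrho X Y + varrho Y Z.
Proof.
move=> [hX [hY [k e]]] [hY' [hZ [j e']]].
rewrite (Prop_irrelevance hY' hY) in e'.
have [{e}k [e _ ->]] := varrho_levels e.
have [{e'}j [e' _ ->]] := varrho_levels e'.
have [m [_ mmin ->]] := varrho_levels (lev_equiv_comp e e').
have pos n : 0 < 1 + 2 * n%:R :> R by rewrite ltr_wpDr// mulr_ge0.
rewrite -lnM ?posrE//; rewrite ler_ln ?posrE ?mulr_gt0//.
have := mmin _ (lev_equiv_comp e e').
rewrite -(ler_nat R) !natrD !natrM => h.
by nra.
Qed.

End varrho_metric.

(** * Quasi-isometries *)

Section quasi_geodesics.
Variables (R : realType) (T T' : metricType R) (Q : T -> T') (L C : R).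
Hypotheses (gT : geodesic T) (gT' : geodesic T') (tT' : tree_like T').
Hypotheses (L1 : 1 <= L) (C0 : 0 <= C).
Hypothesis hQ : forall x y,
  L^-1 * mdist x y - C <= mdist (Q x) (Q y) <= L * mdist x y + C.
Local Notation d := mdist.

Let L0 : 0 < L. Proof. exact: lt_le_trans L1. Qed.

(** A chain with steps at most [J] that joins two points of a tree comes
    [J]-close to every point between them. *)
Lemma tree_chain (u : nat -> T') (J : R) p N : 0 <= J ->
  (forall i, d (u i) (u i.+1) <= J) -> gpr p (u 0) (u N) = 0 ->
  exists i, d p (u i) <= J.
Proof.
move=> J0 uJ; elim: N => [|N IH] pN.
  by exists 0; move: pN; rewrite /gpr mdistxx; lra.
have := tT' p (u 0) (u N) (u N.+1); rewrite pN.
rewrite ge_min => /orP[le|le].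
  by apply: IH; apply/le_anti; rewrite le gpr_ge0.
exists N; have := uJ N; have := mdist_ge0 p (u N.+1).
by move: le; rewrite /gpr; lra.
Qed.

Lemma qi_upper x y : d (Q x) (Q y) <= L * d x y + C.
Proof. by have /andP[] := hQ x y. Qed.

Lemma qi_lower x y : d x y <= L * (d (Q x) (Q y) + C).
Proof.
by have /andP[h _] := hQ x y; rewrite -ler_pdivrMl// -lerBlDr.
Qed.

(** The image of a geodesic comes close to every point between the images of its
    endpoints. *)
Lemma qi_path x y p : gpr p (Q x) (Q y) = 0 ->
  exists2 a, gpr a x y = 0 & d p (Q a) <= L + C.
Proof.
have LL := L1; have CC := C0; have [g [gi g0 gl]] := gT x y; set l := d x y in gi gl.
have l0 : 0 <= l by exact: mdist_ge0.
pose s (i : nat) : R := Num.min i%:R l.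
have sI i : 0 <= s i <= l by rewrite le_min ler0n l0 ge_min lexx orbT.
move=> pxy; have := @tree_chain (fun i => Q (g (s i))) (L + C) p (Num.truncn l).+1.
case.
- by lra.
- move=> i; apply: le_trans (qi_upper _ _) _; rewrite gi// lerD2r.
  rewrite -[X in _ <= X]mulr1 ler_pM2l; last by lra.
  have [h1 h2] : s i <= s i.+1 /\ s i.+1 <= s i + 1.
    rewrite /s -natr1; have [h|h] := leP (i%:R) l; have [h'|h'] := leP (i%:R + 1) l;
    by split; lra.
  by rewrite ler_norml; lra.
- rewrite /s min_l// min_r ?g0 ?gl//.
  by rewrite ltW// truncnS_gt.
- move=> i di; exists (g (s i)) => //.
  by rewrite -g0 -gl; apply: (iso_on_mid gi); have := sI i; lra.
Qed.

(** The bound provided by the stability of quasi-geodesics below. *)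
Definition morse_const := L * (L * (2 * (L + C) + C)) + C + (L + C).

Lemma morse_const_ge0 : 0 <= morse_const.
Proof. have LL := ltW L0; have CC := C0.
by rewrite /morse_const !(addr_ge0, mulr_ge0, ler0n). Qed.

(** Stability of quasi-geodesics: the image of a point [m] of a geodesic is
    close to the geodesic joining the images of the endpoints. The projection
    [p] of [Q m] is approached both before and after [m], and these two
    approaches have close images, hence are close to [m]. *)
Lemma qi_morse m x y : gpr m x y = 0 -> gpr (Q m) (Q x) (Q y) <= morse_const.
Proof.
have LL := L1; have CC := C0; move=> mxy; have [g [gi g0 gl]] := gT' (Q m) (Q x).
have [pmx pmy _ <-] := tree_median (Q y) tT' gi g0 gl (mdist_ge0 _ _).
set p := g _ in pmx pmy *.
have [a amx pa] := qi_path pmx; have [b bmy pb] := qi_path pmy.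
have dab : d a b = d m a + d m b.
  move: mxy amx bmy => /gpr0_mid mxy /gpr0_mid amx /gpr0_mid bmy.
  have := metric_triangle x a y; have := metric_triangle a b y.
  have := metric_triangle a m b.
  have := metric_sym a m; have := metric_sym b m; have := metric_sym x a.
  by lra.
have dQab : d (Q a) (Q b) <= 2 * (L + C).
  by have := metric_triangle (Q a) p (Q b); rewrite (metric_sym (Q a) p); lra.
have ma : d m a <= L * (2 * (L + C) + C).
  have := qi_lower a b; have := mdist_ge0 m b; rewrite dab => mb0 h.
  have : d m a + d m b <= L * (2 * (L + C) + C).
    by apply: le_trans h _; rewrite ler_pM2l; lra.
  by lra.
have := metric_triangle (Q m) (Q a) p; rewrite (metric_sym (Q a) p).
have := qi_upper m a.
have : L * d m a <= L * (L * (2 * (L + C) + C)) by rewrite ler_pM2l; lra.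
by rewrite /morse_const; lra.
Qed.

End quasi_geodesics.

Section limit_of_rays.
Variables (R : realType) (X : rooted_Rtree R).

(** Completeness of the end space: rays [G n] that coincide pairwise up to
    heights [r n] tending to infinity have a limit. *)
Lemma end_limit (G : nat -> end_space X) (r : nat -> R) :
  (forall n m t, 0 <= t -> t <= r n -> t <= r m -> ev (G n) t = ev (G m) t) ->
  (forall t, exists n, t <= r n) ->
  exists F, forall n t, 0 <= t -> t <= r n -> ev F t = ev (G n) t.
Proof.
move=> GG /choice[N HN].
have gi a : iso_on a (fun t => ev (G (N t)) t).
  move=> s t /andP[s0 _] /andP[t0 _].
  have Ns := GG _ (N (Num.max s t)) s s0 (HN s).
  have Nt := GG _ (N (Num.max s t)) t t0 (HN t).
  rewrite Ns ?Nt ?ev_dist//.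
    by apply: le_trans (HN _); rewrite le_max lexx orbT.
  by apply: le_trans (HN _); rewrite le_max lexx.
have [F FE] := @ev_mk R X (fun t => ev (G (N t)) t) (ev0 _) gi.
by exists F => n t t0 tn; rewrite FE// (GG _ n).
Qed.

End limit_of_rays.

Section boundary_map.
Variables (R : realType) (X Y : rooted_Rtree R).
Hypotheses (hX : in_Tge3 X) (hY : in_Tge3 Y).
Variables (Q : X -> Y) (L C : R).
Hypotheses (L1 : 1 <= L) (C0 : 0 <= C).
Hypothesis hQ : forall x y,
  L^-1 * mdist x y - C <= mdist (Q x) (Q y) <= L * mdist x y + C.
Hypothesis Qsurj : forall y, exists x, mdist (Q x) y <= C.
Local Notation d := mdist.
Local Notation z := (tree_root X).
Local Notation w := (tree_root Y).
Implicit Types (F : end_space X) (G : end_space Y).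

Let L0 : 0 < L. Proof. exact: lt_le_trans L1. Qed.
Let D := d w (Q z).
Let H := morse_const L C + D.
Let D0 : 0 <= D. Proof. exact: mdist_ge0. Qed.
Let M0 : 0 <= morse_const L C. Proof. exact: morse_const_ge0. Qed.
Let H0 : 0 <= H. Proof. exact: addr_ge0. Qed.

Let morse m x y : gpr m x y = 0 -> gpr (Q m) (Q x) (Q y) <= morse_const L C.
Proof.
apply: qi_morse => //.
- exact/Rtree_geodesic/tree_Rtree.
- exact/Rtree_geodesic/tree_Rtree.
- exact: (chart_tree_like (end_chart hY)).
Qed.

(** The image of a ray, sampled at integers. *)
Let q F (n : nat) := Q (ev F n%:R).

Let q_lower F n : n%:R <= L * (d w (q F n) + D + C).
Proof.
have := qi_lower L1 hQ (ev F 0) (ev F n%:R); rewrite ev0 ev_height//.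
move=> /le_trans; apply; rewrite ler_pM2l// lerD2r.
by have := metric_triangle (Q z) w (q F n); rewrite (metric_sym (Q z) w) -/D; lra.
Qed.

Let q_upper F n : d w (q F n) <= L * n%:R + C + D.
Proof.
have := qi_upper hQ (ev F 0) (ev F n%:R); rewrite ev0 ev_height//.
by have := metric_triangle w (Q z) (q F n); rewrite -/D /q; lra.
Qed.

Let q_mid F n m : (n <= m)%N -> gpr (q F n) w (q F m) <= H.
Proof.
move=> nm; apply: (le_trans (gpr_lip _ w (Q z) _)); rewrite /H -/D lerD2r.
rewrite /q -(ev0 F); apply: morse.
by apply: (iso_on_mid (@ev_iso _ _ F m%:R)); rewrite ?ler_nat ?ler0n.
Qed.

Let ray_exists y : exists G, ev G (d w y) = y.
Proof.
by have [G [t [t0 <-]]] := point_on_ray hY y; exists G; rewrite ev_height.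
Qed.

(** A ray through the point [y]. *)
Let ray y := projT1 (cid (ray_exists y)).

Let ev_ray y : ev (ray y) (d w y) = y.
Proof. by rewrite /ray; case: cid. Qed.

Let gpr_ray a b r : 0 <= r -> (r <= gpr w a b) <->
  [/\ r <= d w a, r <= d w b & ev (ray a) r = ev (ray b) r].
Proof.
move=> r0; have da := mdist_ge0 w a; have db := mdist_ge0 w b.
have := chart_gpr (end_chart hY) (ray a) (ray b) (ray a) da db.
rewrite !ev_ray ev0 => ->; rewrite le_meet.
by split=> -[ra rb ag]; split=> //; apply/(ev_agree hY).
Qed.

(** [G] stays close to the image of [F]. *)
Let follows F G := forall n r, 0 <= r -> r <= d w (q F n) - H ->
  ev G r = ev (ray (q F n)) r.

Let far F (r : R) : exists N, forall n, (N <= n)%N -> r <= d w (q F n).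
Proof.
exists (Num.truncn (L * (r + D + C))).+1 => n nN.
have h1 : L * (r + D + C) <= n%:R.
  by apply: le_trans (_ : (Num.truncn (L * (r + D + C))).+1%:R <= _);
    [exact/ltW/truncnS_gt | rewrite ler_nat].
have := le_trans h1 (q_lower F n); rewrite ler_pM2l//; lra.
Qed.

Let bmap_exists F : exists G, follows F G.
Proof.
apply: (@end_limit R Y (fun n => ray (q F n)) (fun n => d w (q F n) - H)) => [n m t|t].
  wlog nm : n m / (n <= m)%N => [wl|].
    have [|/ltnW mn] := leqP n m; first exact: wl.
    by move=> *; apply/esym/wl.
  move=> t0 tn tm; have [] // := (gpr_ray (q F n) (q F m) t0).1.
  by rewrite gpr_swap; have := q_mid F nm; lra.
by have [N HN] := far F (t + H); exists N; have := HN N (leqnn N); lra.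
Qed.

(** The boundary map induced by [Q]. *)
Let f F := projT1 (cid (bmap_exists F)).

Let fP F : follows F (f F).
Proof. by rewrite /f; case: cid. Qed.

(** The rays [f F0] and [f F] separate near the image of the branch point of
    [F0] and [F]. *)
Let f_level F0 F : F0 <> F -> f F0 <> f F /\
  let h := d w (q F0 (elev hX F0 F)) in
  h - H <= (elev hY (f F0) (f F))%:R <= h + H.
Proof.
have HH := H0; have DD := D0; have MM := M0.
move=> nF; set n := elev hX F0 F; pose y := q F0 n; pose h := d w y.
have branch : ev F0 n%:R = ev F n%:R by apply/(elevP hX nF).
have up r : 0 <= r -> ev (f F0) r = ev (f F) r -> r <= h + morse_const L C.
  move=> r0 fr; have [N1 HN1] := far F0 (r + H); have [N2 HN2] := far F (r + H).
  pose N := maxn n (maxn N1 N2).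
  have nN : (n <= N)%N by rewrite leq_maxl.
  have a1 : r + H <= d w (q F0 N) by apply: HN1; rewrite /N; lia.
  have a2 : r + H <= d w (q F N) by apply: HN2; rewrite /N; lia.
  have r_le : r <= gpr w (q F0 N) (q F N).
    apply/gpr_ray => //; split; [lra|lra|].
    by rewrite -!fP//; lra.
  apply: (le_trans r_le); apply: (le_trans (gpr_lip_base w y _ _)).
  rewrite addrC lerD2l; apply: morse; apply/gpr0_mid.
  have nN' : n%:R <= N%:R :> R by rewrite ler_nat.
  rewrite (end_chart hX).2// /meet (asboolF nF) /= minxx -/n min_r//.
  rewrite {2}branch (iso_onE (@ev_iso _ _ F0 N%:R))// (iso_onE (@ev_iso _ _ F N%:R))//.
  by ring.
have fn : f F0 <> f F.
  move=> E; have := up (h + morse_const L C + 1); rewrite E => /(_ _ erefl).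
  by have := mdist_ge0 w y; rewrite -/h; lra.
split => //; rewrite /= -/y -/h; apply/andP; split.
  have [lt|ge] := ltP (h - H) 0; first by apply: (le_trans (ltW lt)).
  have qE : q F n = y by rewrite /y /q branch.
  by apply/(elevP hY fn) => //; rewrite !(fP (n := n)) ?qE.
have : ev (f F0) (elev hY (f F0) (f F))%:R = ev (f F) (elev hY (f F0) (f F))%:R.
  by apply/(elevP hY fn).
have HM : morse_const L C <= H by rewrite /H lerDl.
by move/up => /(_ (ler0n _ _)) /le_trans; apply; rewrite lerD2l.
Qed.

Let f_inj : injective f.
Proof. by move=> F0 F E; apply: contrapT => /f_level[]. Qed.

Let f_bounded : @lev_bounded (end_lev hX) (end_lev hY) (Num.truncn (2 * H)).+1 f.
Proof.
move=> F0 F F' n1 n2 /= e; have [_ /andP[_]] := f_level n1.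
have [_ /andP[+ _]] := f_level n2; rewrite -e => h1 h2.
rewrite -(ler_nat R) natrD.
by have := truncnS_gt (2 * H); lra.
Qed.

Let g_bound F0 F F' : F0 <> F -> F0 <> F' ->
  elev hY (f F0) (f F) = elev hY (f F0) (f F') ->
  (elev hX F0 F <= elev hX F0 F' + (Num.truncn (L * (4 * H + C))).+1)%N.
Proof.
move=> n1 n2 e; have [//|lt] := leqP (elev hX F0 F) (elev hX F0 F').
  by move=> le; apply: (leq_trans le); rewrite leq_addr.
have [_ /andP[h1 h2]] := f_level n1; have [_ /andP[h3 h4]] := f_level n2.
rewrite e in h1 h2; set n := elev hX F0 F in lt h1 h2 *.
set n' := elev hX F0 F' in lt h3 h4 *.
have := q_mid F0 (ltnW lt); rewrite /gpr (metric_sym (q F0 n') w) => mid.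
have dq : d (q F0 n') (q F0 n) <= 4 * H by lra.
have := qi_lower L1 hQ (ev F0 n'%:R) (ev F0 n%:R).
rewrite (iso_onE (@ev_iso _ _ F0 n%:R)) ?ler_nat ?(ltnW lt)// => low.
have low2 : n%:R - n'%:R <= L * (4 * H + C).
  by apply: (le_trans low); rewrite ler_pM2l// lerD2r.
rewrite -(ler_nat R) natrD.
by have := truncnS_gt (L * (4 * H + C)); lra.
Qed.

(** Coarse surjectivity of [Q] provides ends [F n] whose images agree with [G]
    up to height [n], up to a constant; they converge. *)
Let f_surj G : exists F, f F = G.
Proof.
have HH := H0; have DD := D0; have LL := L1; have CC := C0.
pose C2 := L + C + C.
have C20 : 0 <= C2 by rewrite /C2; lra.
have ex n : exists F, forall t, 0 <= t -> t <= n%:R - C2 - H -> ev (f F) t = ev G t.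
  have [x Qx] := Qsurj (ev G n%:R).
  have [F [s [s0 Fs]]] := point_on_ray hX x; exists F => t t0 tn.
  pose s' := Num.truncn s; pose y := q F s'.
  have dy : d y (ev G n%:R) <= C2.
    have := metric_triangle y (Q x) (ev G n%:R).
    have := qi_upper hQ (ev F s'%:R) (ev F s); rewrite -/(q F s') -/y Fs.
    have /andP[s1 s2] := truncn_itv s0; rewrite -/s' in s1 s2.
    rewrite -Fs (iso_onE (@ev_iso _ _ F s))//.
    have : L * (s - s'%:R) <= L * 1 by rewrite ler_pM2l//; move: s2; rewrite -natr1; lra.
    by rewrite /C2; move: Qx; rewrite -Fs; lra.
  have hy : n%:R - C2 <= d w y.
    have := metric_triangle w y (ev G n%:R); rewrite ev_height//; lra.
  rewrite (fP (n := s'))//; last by rewrite -/y; lra.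
  have [] // := (gpr_ray y (ev G n%:R) t0).1.
    by rewrite /gpr ev_height//; lra.
  move=> _ tn' ->; rewrite ev_height// in tn'.
  apply: (ev_agree_le t0 tn').
  by have := ev_ray (ev G n%:R); rewrite ev_height.
have [Fn HF] := choice ex.
(* the sources of ends that coincide up to height n coincide up to height r n *)
pose r n := (n%:R - C2 - 2 * H - C - D) / L.
have rE n : L * r n = n%:R - C2 - 2 * H - C - D by rewrite /r mulrC divfK// gt_eqF.
have lvl F F' a : f F <> f F' -> a <= (elev hY (f F) (f F'))%:R ->
    a - H - C - D <= L * (elev hX F F')%:R.
  move=> nf al; have nF : F <> F' by move=> E; apply: nf; rewrite E.
  have [_ /andP[_]] := f_level nF; have := q_upper F (elev hX F F'); lra.
have [F FE] : exists F, forall n t, 0 <= t -> t <= r n -> ev F t = ev (Fn n) t.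
  apply: end_limit => [n m t t0 tn tm|t].
    have [->//|nF] := pselect (Fn n = Fn m).
    have [nf _] := f_level nF.
    apply/(elevP hX nF) => //; rewrite -(ler_pM2l L0).
    wlog nm : n m tn tm nF nf / (n <= m)%N => [wl|].
      have [|/ltnW mn] := leqP n m; first exact: wl.
      have -> : elev hX (Fn n) (Fn m) = elev hX (Fn m) (Fn n).
        exact: (lev_sym (Fn n : end_lev hX)).
      apply: wl => //; exact: nesym.
    have nm' : n%:R <= m%:R :> R by rewrite ler_nat.
    have Ltn : L * t <= L * r n by rewrite ler_pM2l.
    apply: (le_trans Ltn); rewrite rE.
    have [neg|pos] := ltP (n%:R - C2 - H) 0.
      apply: (@le_trans _ _ 0); first by lra.
      by rewrite mulr_ge0// ltW.
    have := lvl _ _ (n%:R - C2 - H) nf; rewrite (_ : _ - H - C - D = n%:R - C2 - 2 * H - C - D).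
      apply; apply/(elevP hY nf) => //; rewrite !HF//; lra.
    by ring.
  exists (Num.truncn (L * t + C2 + 2 * H + C + D)).+1.
  rewrite -(ler_pM2l L0) rE.
  by have := truncnS_gt (L * t + C2 + 2 * H + C + D); lra.
exists F; apply: ev_ext => t t0.
pose n := (Num.truncn (L * (L * (t + H + C + D)) + t + C2 + 2 * H + C + D)).+1.
have := truncnS_gt (L * (L * (t + H + C + D)) + t + C2 + 2 * H + C + D).
rewrite -/n => hn.
have LLt : 0 <= L * (L * (t + H + C + D)).
  by rewrite !mulr_ge0 ?(ltW L0)//; lra.
have HnG : ev (f (Fn n)) t = ev G t by apply: HF => //; lra.
rewrite -HnG; have [->//|nF] := pselect (F = Fn n).
have [nf /andP[lo _]] := f_level nF.
apply/(elevP hY nf) => //; apply: le_trans lo.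
have rn : 0 <= r n.
  by rewrite -(ler_pM2l L0) mulr0 rE; lra.
have le1 : r n <= (elev hX F (Fn n))%:R.
  by apply/(elevP hX nF) => //; apply: FE.
have le2 := le_trans le1 (q_lower F (elev hX F (Fn n))).
have : L * r n <= L * (L * (d w (q F (elev hX F (Fn n))) + D + C)) by rewrite ler_pM2l.
rewrite rE => le3.
have : L * (L * (t + H + C + D)) <= L * (L * (d w (q F (elev hX F (Fn n))) + D + C)).
  by lra.
by rewrite !ler_pM2l//; lra.
Qed.

(** A quasi-isometry induces a bounded distortion equivalence of the ends. *)
Lemma boundary_equiv : exists k, @lev_equiv (end_lev hX) (end_lev hY) k.
Proof.
have [g fgK] := choice f_surj.
have fK : cancel f g by move=> F; apply: f_inj; rewrite fgK.
pose k1 := (Num.truncn (2 * H)).+1; pose k2 := (Num.truncn (L * (4 * H + C))).+1.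
exists (maxn k1 k2), f, g; split => //.
  move=> F0 F F' n1 n2 e; apply: (leq_trans (f_bounded n1 n2 e)).
  by rewrite leq_add2l leq_maxl.
move=> G0 G G' n1 n2 e; apply: (leq_trans (n := (elev hX (g G0) (g G') + k2)%N)).
  apply: g_bound; [| |by rewrite !fgK].
    by move=> E; apply: n1; rewrite -(fgK G0) E fgK.
  by move=> E; apply: n2; rewrite -(fgK G0) E fgK.
by rewrite leq_add2l leq_maxr.
Qed.

End boundary_map.

Lemma qi_bd_equiv (R : realType) (X Y : rooted_Rtree R) :
  in_Tge3 X -> in_Tge3 Y -> quasi_isometric X Y -> bd_equiv X Y.
Proof.
move=> hX hY [Q [L [C [L1 C0 hQ Qs]]]]; exists hX, hY.
exact: (boundary_equiv hX hY L1 C0 hQ Qs).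
Qed.

(** * The tree of a level space *)

(** Points are encoded by the function giving, for each end [G], the height at
    which the ray [G] leaves the segment from the root to the point. *)
Record ltree (R : realType) (E : lev_space) := LTree {
  lt_fun : E -> R;
  lt_ax : exists F t, 0 <= t /\ lt_fun = fun G => meet F t G t
}.

Section level_tree_metric.
Variables (R : realType) (E : lev_space).
Local Notation T := (ltree R E).
Implicit Types (F G H : E) (p q : T).

HB.instance Definition _ := gen_eqMixin T.
HB.instance Definition _ := gen_choiceMixin T.

(** The point at height [t >= 0] on the ray [F]. *)
Definition lpt F (t : R) : T :=
  LTree (ex_intro _ F (ex_intro _ `|t| (conj (normr_ge0 t) erefl))).

Lemma lpt_surj p : exists F t, 0 <= t /\ lpt F t = p.
Proof.
case: p => f ax; have [F [t [t0 fE]]] := ax; exists F, t; split => //.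
rewrite /lpt; move: (ex_intro _ _ _) => ax'; move: ax'.
by rewrite ger0_norm// -fE => ax'; congr LTree; exact: Prop_irrelevance.
Qed.

Lemma agree_le r s F G : r <= s -> @agree R E s F G -> agree r F G.
Proof. by move=> rs [->|le]; [left|right; exact: le_trans le]. Qed.

Lemma meet_agree F F' (s : R) G t : agree s F F' -> meet F s G t = meet F' s G t.
Proof.
suff le A B : agree s A B -> meet A s G t <= meet B s G t.
  by move=> FF'; apply/le_anti; rewrite !le//; exact: agree_sym.
move=> AB; have /le_meet[h1 h2 h3] := lexx (meet A s G t).
apply/le_meet; split => //.
by apply: agree_trans h3; apply: agree_sym; exact: agree_le AB.
Qed.

Lemma lpt_eq F s G t : 0 <= s -> 0 <= t ->
  (lpt F s = lpt G t) <-> s = t /\ agree s F G.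
Proof.
move=> s0 t0; split=> [[]|[<-{t t0} ag]].
  rewrite !ger0_norm// => E1.
  have := congr1 (fun h => h F) E1; have := congr1 (fun h => h G) E1 => /=.
  rewrite !meet_diag !minxx => e1 e2.
  have /le_meet[h1 h2 h3] : t <= meet F s G s by rewrite e1.
  have /le_meet[h4 h5 h6] : s <= meet G t F t by rewrite -e2.
  have st : s = t by apply/le_anti; rewrite h1 h4.
  by split => //; exact: agree_sym.
rewrite /lpt; move: (ex_intro _ F _) (ex_intro _ G _).
have -> : (fun H => meet F `|s| H `|s|) = (fun H => meet G `|s| H `|s|).
  by apply/funext => H; apply: meet_agree; rewrite ger0_norm.
by move=> a b; congr LTree; exact: Prop_irrelevance.
Qed.

Let rep p := cid (lpt_surj p).
Let repE p : E := projT1 (rep p).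
Let repT p : R := projT1 (cid (projT2 (rep p))).

Let repP p : 0 <= repT p /\ lpt (repE p) (repT p) = p.
Proof. by rewrite /repT /repE; case: (cid _). Qed.

(** The distance of the tree, through an arbitrary ray and height for each
    point. *)
Definition lt_dist p q : R :=
  repT p + repT q - 2 * meet (repE p) (repT p) (repE q) (repT q).

Lemma lt_distE F G s t : 0 <= s -> 0 <= t ->
  lt_dist (lpt F s) (lpt G t) = s + t - 2 * meet F s G t.
Proof.
move=> s0 t0; rewrite /lt_dist.
have [a0 /lpt_eq[]//] := repP (lpt F s); have [b0 /lpt_eq[]//] := repP (lpt G t).
move=> -> agG -> agF; rewrite (meet_agree _ _ agF).
by rewrite meet_sym (meet_agree _ _ agG) meet_sym.
Qed.

Let meet_le F (s : R) G (t : R) : meet F s G t <= s /\ meet F s G t <= t.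
Proof. by have /le_meet[] := lexx (meet F s G t). Qed.

Let lt_distxx p : lt_dist p p = 0.
Proof.
have [F [t [t0 <-]]] := lpt_surj p.
by rewrite lt_distE// meet_diag minxx; ring.
Qed.

Let lt_dist_eq0 p q : lt_dist p q = 0 -> p = q.
Proof.
have [F [s [s0 <-]]] := lpt_surj p; have [G [t [t0 <-]]] := lpt_surj q.
rewrite lt_distE// => e; have [h1 h2] := meet_le F s G t.
have st : s = t by lra.
apply/lpt_eq => //; split => //.
have /le_meet[//] : s <= meet F s G t by lra.
Qed.

Let lt_dist_sym p q : lt_dist p q = lt_dist q p.
Proof. by rewrite /lt_dist meet_sym [repT p + _]addrC. Qed.

Let lt_dist_triangle q p r : lt_dist p r <= lt_dist p q + lt_dist q r.
Proof.
have [F [s [s0 <-]]] := lpt_surj p; have [G [t [t0 <-]]] := lpt_surj q.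
have [H [u [u0 <-]]] := lpt_surj r; rewrite !lt_distE//.
have := meet_ultra F s G t H u.
have [_ h1] := meet_le F s G t; have [h2 _] := meet_le G t H u.
by rewrite ge_min => /orP[] ?; lra.
Qed.

HB.instance Definition _ := isMetric.Build R T
  lt_distxx lt_dist_eq0 lt_dist_sym lt_dist_triangle.

Lemma lpt_chart : @chart R E T lpt.
Proof. by split=> [p|F G s t s0 t0]; [exact: lpt_surj|exact: lt_distE]. Qed.

End level_tree_metric.

(** Convergence in the product topology is pointwise, over an index type
    without topology. *)
Lemma ptws_cvg (U : choiceType) (V : topologicalType)
    (A : set_system (U -> V)) (f : U -> V) : Filter A ->
  (forall u, h u @[h --> A] --> f u) -> {ptws, A --> f}.
Proof.
move=> FA cA; rewrite cvg_sup => u.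
rewrite cvg_image; last by rewrite eqEsubset; split=> v // _; exists (cst v).
move=> W /cA; exists (@^~ u @^-1` W) => //.
by rewrite eqEsubset; split => [v [? + <-//]|v Wv]; exists (fun=> v).
Qed.

Section level_tree.
Variables (R : realType) (E : lev_space) (F0 : E).
Hypothesis branching : root_branching E.
Local Notation T := (ltree R E).
Local Notation d := (@mdist R T).
Implicit Types (F G H : E) (x y : T).

Let ch := lpt_chart R E.
Local Notation pt := (@lpt R E).

Let pt_eq F s G t : 0 <= s -> 0 <= t -> (pt F s = pt G t) <-> s = t /\ agree s F G.
Proof. exact: (chart_eq ch). Qed.

(** The tree of the level space [E]; the choice of the ray [F0] through the root
    is immaterial. *)
Definition level_tree : rooted_Rtree R := RootedRtree (pt F0 0) (chart_Rtree ch).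

Lemma level_tree_complete : geodesically_complete level_tree.
Proof.
move=> t f t0 f0 fi.
have fi' r s : 0 <= r <= t -> 0 <= s <= t -> d (f r) (f s) = `|r - s|.
  by move=> rI sI; apply: fi; rewrite in_itv.
have ht r : 0 <= r <= t -> exists F, f r = pt F r.
  move=> rI; have [F [s [s0 Fs]]] := ch.1 (f r); exists F.
  have := fi' 0 r; rewrite f0 -Fs /= (chart_height ch)// sub0r normrN.
  by rewrite ger0_norm; [move=> -> //; lra|lra].
have [|F Ft] := ht t; first by lra.
have fE r : 0 <= r <= t -> f r = pt F r.
  move=> rI; have [G Gr] := ht r rI; rewrite Gr; apply/pt_eq; [lra|lra|split=> //].
  have tI : 0 <= t <= t by lra.
  have := fi' r t rI tI; rewrite Gr Ft ch.2; [|lra|lra].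
  rewrite distrC ger0_norm; last by lra.
  move=> h; have e : r = meet G r F t by lra.
  have /le_meet[_ _] : r <= meet G r F t by rewrite -e.
  exact.
exists (fun s => pt F s%:num).
  by move=> s s'; rewrite (chart_dist ch).
by move=> s st; rewrite fE//; apply/andP.
Qed.

Let isV x := `[< exists F (n : nat), x = pt F n%:R >].
(** The vertices are the points of integral height. *)
Definition lvertex : choiceType := {x : T | isV x}.

Lemma vx_subproof F (n : nat) : isV (pt F n%:R).
Proof. by apply/asboolP; exists F, n. Qed.

(** The vertex at height [n] on the ray [F]. *)
Definition vx F n : lvertex := exist _ (pt F n%:R) (vx_subproof F n).

Lemma vx_surj (v : lvertex) : exists F n, v = vx F n.
Proof.
case: v => x xV; have /asboolP[F [n xE]] := xV; exists F, n.
by apply: val_inj.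
Qed.

Lemma vx_eq F n G m : vx F n = vx G m <-> n = m /\ (F = G \/ (n <= lev F G)%N).
Proof.
split=> [E1|[<- ag]].
  have /pt_eq[] := congr1 val E1 : pt F n%:R = pt G m%:R; [by []|by []|].
  by move=> /eqP; rewrite eqr_nat /agree ler_nat => /eqP ->.
by apply: val_inj => /=; apply/pt_eq => //; rewrite /agree ler_nat.
Qed.

(** The simplices are the vertices and the pairs of consecutive vertices of a
    ray. *)
Definition lsimplex (s : {fset lvertex}) :=
  s <> fset0 /\ exists F n, (s `<=` [fset vx F n; vx F n.+1])%fset.

Lemma lsimplex0 : ~ lsimplex fset0. Proof. by case. Qed.

Lemma lsimplex1 v : lsimplex [fset v]%fset.
Proof.
split; first by move/eqP; rewrite -cardfs_eq0 cardfs1.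
have [F [n ->]] := vx_surj v; exists F, n.
by apply/fsubsetP => u /fset1P ->; exact: fset21.
Qed.

Lemma lsimplex_sub (s t : {fset lvertex}) :
  (s `<=` t)%fset -> s != fset0 -> lsimplex t -> lsimplex s.
Proof.
move=> st /eqP s0 [_ [F [n tE]]]; split => //; exists F, n.
exact: fsubset_trans tE.
Qed.

Definition lcomplex := SimplicialComplex lsimplex0 lsimplex1 lsimplex_sub.

(** The barycentric coordinate of [x] at a vertex decreases linearly from 1 to 0
    on the star of this vertex. *)
Definition lcoord x (v : lvertex) : R := Num.max 0 (1 - d x (val v)).

Lemma lcoord_ge0 x v : 0 <= lcoord x v.
Proof. by rewrite le_max lexx. Qed.

(** A vertex at distance less than one from a point lies on every ray through
    this point. *)
Lemma lcoord_gt0 F (t : R) v : 0 <= t -> 0 < lcoord (pt F t) v ->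
  exists m : nat, [/\ v = vx F m, `|t - m%:R| < 1 & lcoord (pt F t) v = 1 - `|t - m%:R|].
Proof.
move=> t0; have [G [m ->]] := vx_surj v.
rewrite /lcoord /= lt_max ltxx /= => d1.
have ag : F = G \/ (m <= lev F G)%N.
  have [FG|FG] := pselect (F = G); [by left|right].
  rewrite leqNgt; apply/negP => lt.
  have lt' : (lev F G)%:R + 1 <= m%:R :> R by rewrite natr1 ler_nat.
  move: d1; rewrite ch.2// /meet (asboolF FG).
  have h1 : Num.min (Num.min t m%:R) (lev F G)%:R <= t by rewrite !ge_min lexx.
  have h2 : Num.min (Num.min t m%:R) (lev F G)%:R <= (lev F G)%:R :> R.
    by rewrite ge_min lexx orbT.
  by lra.
have vE : vx G m = vx F m.
  by apply/esym/vx_eq.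
exists m; move: d1; rewrite (congr1 val vE : pt G m%:R = pt F m%:R) (chart_dist ch)// => d1.
by split => //; [lra|rewrite max_r ?ltW].
Qed.

(** The coordinates of a point of the edge between the heights [n] and [n + 1]
    on [F]. *)
Lemma lcoord_pair F n (t : R) : n%:R <= t <= n.+1%:R ->
  [/\ lcoord (pt F t) (vx F n) = 1 - (t - n%:R),
      lcoord (pt F t) (vx F n.+1) = t - n%:R &
      forall v, v <> vx F n -> v <> vx F n.+1 -> lcoord (pt F t) v = 0].
Proof.
rewrite -natr1 => tI; have t0 : 0 <= t.
  by apply: le_trans (_ : n%:R <= _); [rewrite ler0n|lra].
split=> [||v v1 v2].
- by rewrite /lcoord /= (chart_dist ch)// ger0_norm ?max_r//; lra.
- rewrite /lcoord /= (chart_dist ch)// -natr1 distrC ger0_norm; last by lra.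
  by rewrite max_r; lra.
- apply/le_anti; rewrite lcoord_ge0 andbT leNgt; apply/negP => /(lcoord_gt0 t0).
  move=> [m [vm tm _]]; move: tm; rewrite ltr_norml => tm.
  have m1 : (m < n.+2)%N by rewrite -(ltr_nat R) -!natr1; lra.
  have m2 : (n < m.+1)%N by rewrite -(ltr_nat R) -!natr1; lra.
  have [mn|mn] : m = n \/ m = n.+1 by lia.
    by apply: v1; rewrite vm mn.
  by apply: v2; rewrite vm mn.
Qed.

Let floor_exists (t : R) : 0 <= t -> exists n : nat, n%:R <= t < n.+1%:R.
Proof. by move=> t0; exists (Num.truncn t); exact: truncn_itv. Qed.

Let vx_succ F n G m : n <> m -> vx F n <> vx G m.
Proof. by move=> nm /vx_eq[]. Qed.

Lemma lcoord_real x : realization (R := R) lcomplex (lcoord x).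
Proof.
have [F [t [t0 <-]]] := ch.1 x; have [n tn] := floor_exists t0.
have [|cn cn1 c0] := @lcoord_pair F n t; first by lra.
pose A := [fset vx F n; vx F n.+1]%fset.
pose s := [fset v in A | lcoord (pt F t) v != 0]%fset.
have sA : (s `<=` A)%fset by apply: fset_sub.
have sE v : (lcoord (pt F t) v != 0) = (v \in s).
  rewrite /s !inE /=; case: eqP => [|nz]; rewrite ?andbF// andbT.
  apply/esym/negPn/negP; rewrite negb_or => /andP[/eqP h1 /eqP h2].
  by apply: nz; apply: c0.
have s1 : \sum_(v <- s) lcoord (pt F t) v = 1.
  rewrite (big_fset_incl _ sA).
    rewrite big_fsetU1 /= ?big_seq_fset1 ?cn ?cn1; first by ring.
    by apply/negP => /fset1P/vx_succ; apply.
  by move=> v _; rewrite -sE negbK => /eqP.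
exists s; last by split => //; move=> v; exact: lcoord_ge0.
split; last by exists F, n.
by move=> s0; move: s1; rewrite s0 big_seq_fset0 => /esym/eqP; rewrite oner_eq0.
Qed.

(** The two coordinates of a point on an edge determine it; closeness of these
    coordinates bounds the distance. *)
Lemma lcoord_close F n (t : R) (del : R) y : n%:R <= t < n.+1%:R ->
  0 < del -> del <= 1 - (t - n%:R) -> (n%:R < t -> del <= t - n%:R) ->
  `|lcoord (pt F t) (vx F n) - lcoord y (vx F n)| < del ->
  `|lcoord (pt F t) (vx F n.+1) - lcoord y (vx F n.+1)| < del ->
  d (pt F t) y < del.
Proof.
move=> tn del0 d1 d2; have [|-> -> _] := @lcoord_pair F n t; first by lra.
have t0 : 0 <= t by apply: le_trans (_ : n%:R <= _); [rewrite ler0n|lra].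
have [G [s [s0 <-]]] := ch.1 y; rewrite !ltr_norml => y1 y2.
have p1 : 0 < lcoord (pt G s) (vx F n) by lra.
have [m [vE dsm sE]] := lcoord_gt0 s0 p1; rewrite sE in y1.
have /vx_eq[nm ag] := vE; subst m; move: (tn) => /andP[tn1 _].
move: tn1; rewrite le_eqVlt => /orP[/eqP tE|tlt].
  have -> : pt F t = pt G n%:R.
    by apply/pt_eq => //; split => //; case: ag => [->|ag]; [left|right; rewrite -tE ler_nat].
  by rewrite metric_sym (chart_dist ch)//; move: y1; rewrite -tE; lra.
have p2 : 0 < lcoord (pt G s) (vx F n.+1) by have := d2 tlt; lra.
have [m [vE' dsm' sE']] := lcoord_gt0 s0 p2; rewrite sE' in y2.
have /vx_eq[nm ag'] := vE'; subst m.
have sI : n%:R < s < n.+1%:R.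
  move: dsm dsm'; rewrite !ltr_norml -natr1; lra.
have ag2 : @agree R E n.+1%:R F G.
  by case: ag' => [->|h]; [left|right; rewrite ler_nat].
have -> : pt G s = pt F s.
  by apply/esym/pt_eq => //; split => //; apply: agree_le ag2; lra.
rewrite (chart_dist ch)//.
by move: y1; rewrite (ger0_norm (_ : 0 <= s - n%:R)) ?ltr_norml; lra.
Qed.

Lemma lcoord_inj x y : lcoord x = lcoord y -> x = y.
Proof.
have [F [t [t0 <-]]] := ch.1 x; have [n tn] := floor_exists t0 => E1.
apply: contrapT => /eqP; rewrite -mdist_gt0 => dxy.
pose del := Num.min (d (pt F t) y)
  (Num.min (1 - (t - n%:R)) (if n%:R < t then t - n%:R else 1)).
have [h1 h2 h3] : [/\ del <= d (pt F t) y, del <= 1 - (t - n%:R) &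
    del <= if n%:R < t then t - n%:R else 1].
  by rewrite /del !ge_min !lexx !orbT.
have del0 : 0 < del.
  rewrite !lt_min dxy /=; apply/andP; split; first by move: tn; rewrite -natr1; lra.
  by case: ifP => // nt; lra.
have : d (pt F t) y < del.
  apply: (lcoord_close tn del0 h2) => [nt||]; rewrite ?E1 ?subrr ?normr0//.
  by rewrite nt in h3.
by move/lt_le_trans => /(_ _ h1); rewrite ltxx.
Qed.

Lemma lcoord_bij : set_bij [set: T] (realization lcomplex) lcoord.
Proof.
split=> [x _|x y _ _|a]; [exact: lcoord_real|exact: lcoord_inj|].
move=> [s [_ [F [n sA]]] [a0 sE s1]].
have az v : v <> vx F n -> v <> vx F n.+1 -> a v = 0.
  move=> v1 v2; apply/eqP/negPn/negP; rewrite sE => /(fsubsetP sA)/fset2P.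
  by case.
have a1 : a (vx F n) + a (vx F n.+1) = 1.
  rewrite -s1 (big_fset_incl _ sA).
    rewrite big_fsetU1 /= ?big_seq_fset1//.
    by apply/negP => /fset1P/vx_succ; apply.
  by move=> v _; rewrite -sE negbK => /eqP.
have [h1 h2] := (a0 (vx F n), a0 (vx F n.+1)).
have [|cn cn1 c0] := @lcoord_pair F n (n%:R + a (vx F n.+1)).
  by rewrite -natr1; lra.
exists (pt F (n%:R + a (vx F n.+1))) => //.
apply/funext => v; have [->|v1] := pselect (v = vx F n); first by rewrite cn; lra.
have [->|v2] := pselect (v = vx F n.+1); first by rewrite cn1; ring.
by rewrite c0// az.
Qed.

Let lcoord_lip x y v : `|lcoord x v - lcoord y v| <= d x y.
Proof.
have h1 := metric_triangle x y (val v); have h2 := metric_triangle y x (val v).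
rewrite (metric_sym y x) in h2; have := mdist_ge0 x y.
rewrite /lcoord ler_norml; set a := d x (val v) in h1 h2 *; set b := d y (val v) in h1 h2 *.
by have [p|p] := leP 0 (1 - a); have [q|q] := leP 0 (1 - b) => dxy; apply/andP; split; lra.
Qed.

(** Coordinates are 1-Lipschitz; conversely the coordinates at the two ends of
    an edge containing a point control the neighbourhoods of this point. *)
Lemma lcoord_top (U : set T) : open U <->
  exists2 W : set {ptws lvertex -> R}, open W & U = lcoord @^-1` W.
Proof.
split=> [oU|[W oW ->]]; last first.
  apply: (open_comp (f := lcoord : T -> {ptws lvertex -> R})) => // x _.
  have FF : Filter (lcoord y @[y --> x]) := fmap_filter _ (nbhs_filter x).
  suff : {ptws, (lcoord y @[y --> x]) --> lcoord x} by [].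
  apply: (ptws_cvg FF) => v; apply/cvgrPdist_lt => e e0.
  suff : nbhs x [set y | `|lcoord x v - lcoord y v| < e] by [].
  rewrite -metricType_numDomainType.filter_from_mdist_nbhs.
  by exists e => // y /= dxy; exact: le_lt_trans (lcoord_lip _ _ _) dxy.
pose Ws := [set W : set {ptws lvertex -> R} | open W /\ lcoord @^-1` W `<=` U].
exists (\bigcup_(W in Ws) W); first by apply: bigcup_open => W [].
apply/seteqP; split=> [x Ux|x [W [_ WU] Wx]]; last exact: WU.
have : nbhs x U by apply: open_nbhs_nbhs; split.
rewrite -metricType_numDomainType.filter_from_mdist_nbhs => -[e /= e0 eU].
have [F [t [t0 xE]]] := ch.1 x; have [n tn] := floor_exists t0; subst x.
pose del := Num.min e
  (Num.min (1 - (t - n%:R)) (if n%:R < t then t - n%:R else 1)).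
have [h1 h2 h3] : [/\ del <= e, del <= 1 - (t - n%:R) &
    del <= if n%:R < t then t - n%:R else 1].
  by rewrite /del !ge_min !lexx !orbT.
have del0 : 0 < del.
  rewrite !lt_min e0 /=; apply/andP; split; first by move: tn; rewrite -natr1; lra.
  by case: ifP => // nt; lra.
pose O v := (fun a : {ptws lvertex -> R} => a v) @^-1` (ball (lcoord (pt F t) v) del).
have oO v : open (O v).
  apply: open_comp; last exact: ball_open.
  by move=> a _; exact: (@proj_continuous lvertex (fun=> R : topologicalType) v).
exists (O (vx F n) `&` O (vx F n.+1)); last by split; exact: ballxx.
split; first exact: openI.
move=> y [y1 y2]; apply: eU => /=; apply: lt_le_trans h1.
apply: (lcoord_close tn del0 h2) => [nt||].
- by rewrite nt in h3.
- exact: y1.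
- exact: y2.
Qed.

Lemma lcoord_edge v w : v != w -> lcomplex [fset v; w]%fset ->
  isometric_to_itv
    [set x | forall u, u \notin [fset v; w]%fset -> lcoord x u = 0] 1.
Proof.
move=> vw [_ [F [n vwA]]].
have AE : [fset v; w]%fset = [fset vx F n; vx F n.+1]%fset.
  apply/eqP; rewrite eqEfcard vwA /= !cardfs2 vw.
  by case: (_ == _).
rewrite AE {v w vw vwA AE}.
exists (fun r => pt F (n%:R + r)); last first.
  move=> r s; rewrite !in_itv/= => rI sI; rewrite (chart_dist ch).
  - by rewrite (_ : _ - _ = r - s)//; ring.
  - by rewrite addr_ge0//; lra.
  - by rewrite addr_ge0//; lra.
apply/seteqP; split=> [_ [r /= + <-]|x /= xA].
  rewrite in_itv/= => rI u; rewrite in_fset2 negb_or => /andP[/eqP u1 /eqP u2].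
  have [|_ _ c0] := @lcoord_pair F n (n%:R + r); first by rewrite -natr1; lra.
  exact: c0.
have [G [t [t0 xE]]] := ch.1 x; have [k tk] := floor_exists t0.
have [|ck ck1 _] := @lcoord_pair G k t; first by lra.
have inA v : lcoord x v <> 0 -> v = vx F n \/ v = vx F n.+1.
  move=> nz; apply/fset2P; apply: contrapT => /negP nv; apply: nz; exact: xA.
rewrite -xE in inA.
have vk : vx G k = vx F n \/ vx G k = vx F n.+1.
  by apply: inA; rewrite ck; move: tk; rewrite -natr1; lra.
have vk1 : k%:R < t -> vx G k.+1 = vx F n \/ vx G k.+1 = vx F n.+1.
  by move=> kt; apply: inA; rewrite ck1; lra.
have atv j : t = k%:R -> vx G k = vx F j -> x = pt F j%:R.
  by move=> tE vE; rewrite -xE tE; exact: (congr1 (fun v : lvertex => val v) vE).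
have [tE|tne] := pselect (t = k%:R).
  case: vk => /(atv _ tE) ->.
    by exists 0; rewrite ?addr0 //= in_itv/= lexx ler01.
  by exists 1; rewrite ?natr1 //= in_itv/= lexx ler01.
have kt : k%:R < t by rewrite lt_neqAle; case/andP: tk => -> _; rewrite andbT; apply/eqP; exact: nesym.
have kn : k = n.
  by case: (vk1 kt) => /vx_eq[] ?; case: vk => /vx_eq[] ?; lia.
subst k; exists (t - n%:R); first by rewrite /= in_itv/=; move: tk; rewrite -natr1; lra.
rewrite -xE (_ : n%:R + _ = t); last by ring.
case: (vk1 kt) => /vx_eq[]; first by lia.
move=> _ ag; apply/esym/pt_eq => //; split => //.
apply: (@agree_le _ _ _ n.+1%:R); first by lra.
by case: ag => [->|h]; [left|right; rewrite ler_nat].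
Qed.

Definition level_structure : simplicial_structure T :=
  SimplicialStructure lcoord_bij lcoord_top lcoord_edge.

Lemma level_tree_Tge3 : in_Tge3 level_tree.
Proof.
split; first exact: level_tree_complete.
exists (level_structure : simplicial_structure level_tree); split.
  exists (vx F0 0); have [|c0 _ _] := @lcoord_pair F0 0 0; first by rewrite lexx ler01.
  suff : lcoord (pt F0 0) (vx F0 0) = 1 by [].
  by rewrite c0; ring.
move=> v; have [F [n ->]] := vx_surj v; apply/card3P.
have nb G m : G = F \/ (n <= lev F G)%N -> m = n.+1 ->
    neighbours (level_structure : simplicial_structure level_tree) (vx F n) (vx G m).
  move=> ag ->; have E' : vx F n = vx G n.
    by apply/vx_eq; split => //; case: ag => [->|?]; [left|right].
  split; first by apply/eqP; rewrite E'; apply: vx_succ; lia.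
  split; first by move/eqP; rewrite -cardfs_eq0 cardfs2; case: eqP.
  by exists G, n; rewrite E' fsubset_refl.
have vne A B m : A <> B -> lev A B = m -> vx A m.+1 <> vx B m.+1.
  by move=> nAB lAB /vx_eq[_ [//|]]; rewrite lAB ltnn.
case: n nb => [|n] nb.
  have [G [H [FG FH GH [l1 l2 l3]]]] := branching F.
  exists (vx F 1), (vx G 1), (vx H 1); split; split; try exact: vne.
  - by apply: nb => //; left.
  - by apply: nb => //; right; rewrite l1.
  - by apply: nb => //; right; rewrite l2.
have [G nG lG] := lev_sphere F n.+1.
exists (vx F n), (vx F n.+2), (vx G n.+2); split; split.
- split; first by apply/eqP; apply: vx_succ; lia.
  split; first by move/eqP; rewrite -cardfs_eq0 cardfs2; case: eqP.
  by exists F, n; rewrite fsetUC fsubset_refl.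
- by apply: nb => //; left.
- by apply: nb => //; right; rewrite lG.
- by apply: vx_succ; lia.
- by apply: vx_succ; lia.
- exact: vne.
Qed.

(** The rays of the constructed tree given by the points of the level space. *)
Lemma level_ray F : exists A : end_space level_tree,
  forall t, 0 <= t -> ev A t = pt F t.
Proof.
apply: ev_mk => [|a]; first exact: (chart_root ch).
by move=> s t /andP[s0 _] /andP[t0 _]; exact: (chart_dist ch).
Qed.

End level_tree.

(** * Two distant trees in a quasi-isometry class *)

(** Changing the separation heights by a bounded amount is a quasi-isometry. *)
Lemma chart_qi (R : realType) (E E' : lev_space) (T T' : metricType R)
    (pt : E -> R -> T) (pt' : E' -> R -> T') (f : E -> E') (c : nat) :
  chart pt -> chart pt' -> bijective f ->
  (forall F G, F <> G ->
     (lev F G <= lev (f F) (f G) + c)%N /\ (lev (f F) (f G) <= lev F G + c)%N) ->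
  quasi_isometric T T'.
Proof.
move=> ch ch' [g fg gf] fc.
have meets F (s : R) G (t : R) : meet F s G t - c%:R <= meet (f F) s (f G) t /\
    meet (f F) s (f G) t - c%:R <= meet F s G t.
  split; apply/le_meet.
    have /le_meet[h1 h2 h3] := lexx (meet F s G t).
    split; [by have := ler0n R c; lra..|].
    have [->|FG] := pselect (F = G); [by left|right; case: h3 => // h3].
    have [+ _] := fc _ _ FG; rewrite -(ler_nat R) natrD; lra.
  have /le_meet[h1 h2 h3] := lexx (meet (f F) s (f G) t).
  split; [by have := ler0n R c; lra..|].
  have [->|FG] := pselect (F = G); [by left|right].
  case: h3 => [/(can_inj fg)//|h3].
  by have [_ +] := fc _ _ FG; rewrite -(ler_nat R) natrD; lra.
have /choice[Q HQ] : forall x, exists y, exists F t, [/\ 0 <= t, pt F t = x & y = pt' (f F) t].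
  by move=> x; have [F [t [t0 Ft]]] := ch.1 x; exists (pt' (f F) t), F, t.
exists Q, 1, (2 * c%:R); split.
- by [].
- by rewrite mulr_ge0.
- move=> x y; have [F [s [s0 <- ->]]] := HQ x; have [G [t [t0 <- ->]]] := HQ y.
  rewrite invr1 !mul1r ch.2// ch'.2//.
  by have [h1 h2] := meets F s G t; apply/andP; split; lra.
- move=> y; have [G [t [t0 <-]]] := ch'.1 y; exists (pt (g G) t).
  have [F [s [s0 Fs ->]]] := HQ (pt (g G) t).
  have [st ag] := (chart_eq ch F (g G) s0 t0).1 Fs; subst s.
  have [h1 _] := meets F t (g G) t; rewrite gf in h1.
  have h2 : t <= meet F t (g G) t by apply/le_meet.
  by rewrite ch'.2//; lra.
Qed.

(** Binary codes of the points of a level space: the digit [i] of [F] tells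
    whether [F] runs, just above height [i], through a distinguished child of
    the vertex it meets at this height. *)
Lemma codes_exist (E : lev_space) (F0 : E) : exists code : E -> nat -> bool,
  (forall F G i, (i < lev F G)%N -> code F i = code G i) /\
  (forall F i, exists G, [/\ F <> G, lev F G = i & code F i <> code G i]).
Proof.
pose same n (F G : E) := F = G \/ (n <= lev F G)%N.
have same_sym n F G : same n F G -> same n G F.
  by case=> [->|h]; [left|right; rewrite lev_sym].
have sameE n F G : same n F G -> same n F = same n G.
  move=> FG; apply/seteqP; split=> H; apply: lev_ultra => //.
  exact: same_sym.
have /choice[r rP] : forall A : set E, exists x, A !=set0 -> A x.
  move=> A; have [[x Ax]|nA] := pselect (A !=set0); first by exists x.
  by exists F0.
pose child F i := r (same i F).
have childP F i : same i F (child F i) by apply: rP; exists F; left.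
exists (fun F i => `[< same i.+1 F (child F i) >]); split=> [F G i FG|F i].
  have s1 : same i.+1 F G by right.
  have s0 : same i F G by right; exact: ltnW.
  by rewrite /child (sameE _ _ _ s0) (sameE _ _ _ s1).
have [Fi|nFi] := pselect (same i.+1 F (child F i)).
  have [G nG lG] := lev_sphere F i; exists G; split => //.
  have s0 : same i F G by right; rewrite lG.
  rewrite (asboolT Fi) /child -(sameE _ _ _ s0) -/(child F i).
  case: asboolP => // Gi.
  have [//|] : same i.+1 F G by apply: lev_ultra Fi _; exact: same_sym.
  by rewrite lG ltnn.
exists (child F i); have nF : F <> child F i by move=> E1; apply: nFi; left.
have lF : lev F (child F i) = i.
  apply/eqP; rewrite eqn_leq; apply/andP; split; last by case: (childP F i).
  by rewrite leqNgt; apply/negP => lt; apply: nFi; right.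
split => //; rewrite (asboolF nFi) asboolT //.
by rewrite /child -(sameE _ _ _ (childP F i)); left.
Qed.

(** Both spaces below consist of the points of [E], with other levels that
    differ from those of [E] by at most [m]. The integer [m] exceeds twice [n] by
    one so that vertices at height [n] of the second tree have several
    children. *)
Section two_level_spaces.
Variables (E : lev_space) (F0 : E) (code : E -> nat -> bool) (n : nat).
Hypothesis code_eq : forall F G i, (i < lev F G)%N -> code F i = code G i.
Hypothesis code_flip : forall F i, exists G,
  [/\ F <> G, lev F G = i & code F i <> code G i].
Implicit Types F G H : E.
Local Notation m := (n.*2.+1).

(** All binary words are realized. *)
Lemma code_prefix (b : nat -> bool) j : exists F, forall i, (i < j)%N -> code F i = b i.
Proof.
elim: j => [|j [F IH]]; first by exists F0.
have [e|ne] := eqVneq (code F j) (b j).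
  exists F => i; rewrite ltnS leq_eqVlt => /orP[/eqP ->//|]; exact: IH.
have [G [_ lG cG]] := code_flip F j; exists G => i.
rewrite ltnS leq_eqVlt => /orP[/eqP ->|ij].
  by move: ne cG; case: (code F j); case: (code G j); case: (b j).
by rewrite -IH//; apply/esym/code_eq; rewrite lG.
Qed.

(** The points of [E] seen from height [m]. *)
Definition shallow_lev F G := (lev F G - m)%N.

Let shallow_sym F G : shallow_lev F G = shallow_lev G F.
Proof. by rewrite /shallow_lev lev_sym. Qed.

Let shallow_ultra k F G H : F = G \/ (k <= shallow_lev F G)%N ->
  G = H \/ (k <= shallow_lev G H)%N -> F = H \/ (k <= shallow_lev F H)%N.
Proof.
have [->|k0] := posnP k; first by move=> _ _; right.
have sE A B : (k <= shallow_lev A B)%N = (k + m <= lev A B)%N.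
  by rewrite /shallow_lev; lia.
by rewrite !sE; exact: lev_ultra.
Qed.

Let shallow_sphere F k : exists2 G, F <> G & shallow_lev F G = k.
Proof.
have [G nG lG] := lev_sphere F (k + m)%N; exists G => //.
by rewrite /shallow_lev lG addnK.
Qed.

(** The tree obtained by contracting the ball of radius [m] at the root. *)
Definition shallow : lev_space :=
  LevSpace shallow_sym shallow_ultra shallow_sphere.

Lemma shallow_branching : root_branching shallow.
Proof.
move=> F; have [G nG lG] := lev_sphere (F : E) 0.
have [H nH lH] := lev_sphere (F : E) 1.
have nGH : G <> H by move=> GH; rewrite GH lH in lG.
exists G, H; split => //; split; rewrite /= /shallow_lev ?lG ?lH//.
apply/eqP; rewrite subn_eq0.
suff : ~ (0 < lev G H)%N by lia.
move=> lt; have := @lev_ultra_min E 1 F H G nG.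
by rewrite lH lG lev_sym => /(_ erefl lt).
Qed.

(** The height, at most [n], up to which the codes coincide when their digits
    are read two at a time. *)
Definition code_lev F G : nat :=
  (find (fun i => code F i != code G i) (iota 0 m))./2.

Lemma code_levP j F G : (j <= n)%N ->
  (j <= code_lev F G)%N <-> forall i, (i < j.*2)%N -> code F i = code G i.
Proof.
move=> jn; rewrite /code_lev geq_half_double.
set p := fun i => _; split=> [h i ij|h].
  have im : (i < m)%N by lia.
  have := @before_find _ 0%N p (iota 0 m) i (leq_trans ij h).
  by rewrite nth_iota// add0n /p => /negbFE/eqP.
rewrite leqNgt; apply/negP => lt.
have fm : (find p (iota 0 m) < m)%N by lia.
have hp : has p (iota 0 m) by rewrite has_find size_iota.
have := nth_find 0%N hp; rewrite nth_iota// add0n /p.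
by rewrite h ?eqxx.
Qed.

Lemma code_lev_le F G : (code_lev F G <= n)%N.
Proof.
rewrite /code_lev; have := find_size (fun i => code F i != code G i) (iota 0 m).
by rewrite size_iota; lia.
Qed.

(** Points that separate at a height less than [m] are separated according to
    their codes, the others are pushed up by [n + 1] from the height [m]. *)
Definition deep_lev F G : nat :=
  if (m <= lev F G)%N then (n.+1 + (lev F G - m))%N else code_lev F G.

Let deep_sym F G : deep_lev F G = deep_lev G F.
Proof.
rewrite /deep_lev lev_sym; case: ifP => // _; rewrite /code_lev.
by congr (_./2); apply: eq_find => i; rewrite eq_sym.
Qed.

Lemma deep_levP j F G : (j <= deep_lev F G)%N <->
  (if (j <= n)%N then forall i, (i < j.*2)%N -> code F i = code G i
   else (m + (j - n.+1) <= lev F G)%N).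
Proof.
rewrite /deep_lev; case: ifPn => lm; case: ifPn => jn.
- split=> [_ i ij|_]; last by lia.
  by apply: code_eq; lia.
- by split; lia.
- exact: code_levP.
- by have := code_lev_le F G; split; lia.
Qed.

Let deep_ultra k F G H : F = G \/ (k <= deep_lev F G)%N ->
  G = H \/ (k <= deep_lev G H)%N -> F = H \/ (k <= deep_lev F H)%N.
Proof.
move=> [->//|FG] [<-|GH]; first by right.
have := (deep_levP k F H).2; move: FG GH => /deep_levP + /deep_levP.
case: ifP => kn FG GH h; first by right; apply: h => i ik; rewrite FG ?GH.
have [|FH] := lev_ultra (or_intror FG) (or_intror GH); first by left.
by right; apply: h.
Qed.

Let deep_sphere F k : exists2 G, F <> G & deep_lev F G = k.
Proof.
have [kn|nk] := leqP k n; last first.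
  have [G nG lG] := lev_sphere F (m + (k - n.+1))%N; exists G => //.
  by rewrite /deep_lev lG leq_addr; lia.
have [G [nG lG cG]] := code_flip F k.*2; exists G => //.
have kl : (k <= deep_lev F G)%N.
  by apply/deep_levP; rewrite kn => i ik; apply: code_eq; rewrite lG.
apply/eqP; rewrite eqn_leq kl andbT leqNgt; apply/negP => /deep_levP.
case: ifP => kn' h; first by apply: cG; apply: h; lia.
by move: h; rewrite lG; lia.
Qed.

(** The tree whose vertices at height less than [n] have four children,
    according to two digits of the code, and whose vertices at height [n] have
    as children the vertices at height [m] with the given code. *)
Definition deep : lev_space := LevSpace deep_sym deep_ultra deep_sphere.

Lemma deep_branching : (0 < n)%N -> root_branching deep.
Proof.
move=> n0 F; have [G [nG lG cG]] := code_flip F 0.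
have [H [nH lH cH]] := code_flip F 1.
have c0 : code F 0 = code H 0 by apply: code_eq; rewrite lH.
have lev0 A B i : (i < 2)%N -> code A i <> code B i -> deep_lev A B = 0%N.
  move=> i2 cAB; apply/eqP; rewrite -leqn0 leqNgt; apply/negP => /deep_levP.
  by rewrite n0 => h; apply: cAB; apply: h.
have cGH : code G 0 <> code H 0 by rewrite -c0; exact: nesym.
exists G, H; split => //; first by move=> E1; apply: cGH; rewrite E1.
by split; [apply: (lev0 _ _ 0)|apply: (lev0 _ _ 1)|apply: (lev0 _ _ 0)].
Qed.

Lemma shallow_close F G : (lev F G <= shallow_lev F G + m)%N /\
  (shallow_lev F G <= lev F G + m)%N.
Proof. by rewrite /shallow_lev; lia. Qed.

Lemma deep_close F G : (lev F G <= deep_lev F G + m)%N /\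
  (deep_lev F G <= lev F G + m)%N.
Proof.
rewrite /deep_lev; have := code_lev_le F G.
by case: ifPn => h; lia.
Qed.

End two_level_spaces.

(** The rays of the constructed tree separate at the prescribed levels. *)
Lemma level_ray_lev (R : realType) (E : lev_space) (F0 : E)
    (hT : in_Tge3 (level_tree R F0)) (F G : E) (A B : end_space (level_tree R F0)) :
  (forall t, 0 <= t -> ev A t = lpt F t) -> (forall t, 0 <= t -> ev B t = lpt G t) ->
  F <> G -> A <> B /\ elev hT A B = lev F G.
Proof.
move=> AF BG FG.
have key u : 0 <= u -> ev A u = ev B u <-> u <= (lev F G)%:R.
  move=> u0; rewrite AF// BG//; split=> [/lpt_eq[]//|le]; first by move=> _ [].
  by apply/lpt_eq => //; split => //; right.
have AB : A <> B.
  move=> AB; have : (lev F G).+1%:R <= (lev F G)%:R :> R.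
    by apply/(key _ (ler0n _ _)); rewrite AB.
  by rewrite ler_nat ltnn.
split => //; apply/eqP; rewrite -(eqr_nat R) eq_le; apply/andP; split.
  by apply/(key _ (ler0n _ _))/(elevP hT AB).
by apply/(elevP hT AB)/key.
Qed.

Section distant_trees.
Variables (R : realType) (E : lev_space) (F0 : E).
Variables (code : E -> nat -> bool) (n : nat).
Hypothesis code_eq : forall F G i, (i < lev F G)%N -> code F i = code G i.
Hypothesis code_flip : forall F i, exists G,
  [/\ F <> G, lev F G = i & code F i <> code G i].
Local Notation m := (n.*2.+1).
Local Notation X := (level_tree R (F0 : shallow E n)).
Local Notation Y := (level_tree R (F0 : deep n code_eq code_flip)).
Variables (hX : in_Tge3 X) (hY : in_Tge3 Y).

(** A map of distortion [e^k] from [X] to [Y] sends the ends that separate at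
    the root of [X] to ends that separate at height at most [k]. The root of [X]
    has at least [2^m] children, and [Y] has at most [4^n] vertices at height
    [n]. *)
Lemma distant_trees k : @lev_equiv (end_lev hX) (end_lev hY) k -> (n <= k)%N.
Proof.
move=> [f [g [fg gf bf _]]]; rewrite leqNgt; apply/negP => kn.
have /choice[B HB] : forall b : m.-tuple bool, exists F : E,
    forall i, (i < m)%N -> code F i = nth false b i.
  by move=> b; exact: (code_prefix F0 code_eq code_flip).
have /choice[A HA] : forall b : m.-tuple bool, exists A : end_space X,
    forall t, 0 <= t -> ev A t = lpt (B b : shallow E n) t.
  by move=> b; exact: level_ray.
have AA b b' : b <> b' -> A b <> A b' /\ elev hX (A b) (A b') = 0%N.
  move=> bb; have [i im bi] : exists2 i, (i < m)%N & nth false b i <> nth false b' i.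
    apply: contrapT => /forall2NP h; apply: bb; apply: val_inj.
    apply: (@eq_from_nth _ false); first by rewrite !size_tuple.
    move=> i; rewrite size_tuple => im; have [//|] := h i.
    by move/contrapT.
  have cB : code (B b) i <> code (B b') i by rewrite !HB.
  have nB : B b <> B b' by move=> E1; apply: cB; rewrite E1.
  have [nA ->] := level_ray_lev hX (HA b) (HA b') nB.
  split => //; apply/eqP; rewrite subn_eq0 leqNgt; apply/negP => lt.
  by apply: cB; apply: code_eq; lia.
have /choice[hd Hhd] : forall G : end_space Y, exists H : E,
    ev G n%:R = lpt (H : deep n code_eq code_flip) n%:R.
  move=> G; have [H [t [t0 Ht]]] := lpt_surj (ev G n%:R); exists H; rewrite -Ht.
  suff -> : t = n%:R by [].
  rewrite -(ev_height G (ler0n R n)) -Ht.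
  by rewrite /= (chart_height (lpt_chart R (deep n code_eq code_flip))).
(* the address of the vertex at height [n] on the image of the ray [A b] *)
pose c (b : m.-tuple bool) := [tuple code (hd (f (A b))) i | i < n.*2].
have cinj : injective c.
  move=> b b' cE; apply: contrapT => bb; have [nA l0] := AA _ _ bb.
  have nf : f (A b) <> f (A b') by move/(can_inj fg).
  have := lev_bounded_root (can_inj fg) bf _ nA l0.
  move=> /(_ (fun G => ex_intro _ (g G) (gf G))).
  apply/negP; rewrite -ltnNge; apply: leq_trans kn _.
  rewrite -(ler_nat R); apply/(elevP hY nf) => //; rewrite !Hhd.
  apply/lpt_eq => //; split => //; right; rewrite ler_nat.
  apply: (deep_levP n code_eq n _ _).2; rewrite leqnn => i i2.
  have := congr1 (fun u => tnth u (Ordinal i2)) cE.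
  by rewrite !tnth_mktuple.
have := leq_card c cinj; rewrite !card_tuple card_bool leq_exp2l//.
by rewrite ltnn.
Qed.

End distant_trees.

(** The least exponent [k] relating the two trees is at least [n], and
    [varrho = ln (1 + 2 * k)]. *)
Lemma varrho_unbounded (R : realType) (Z : rooted_Rtree R) (hZ : in_Tge3 Z) (M : R) :
  exists X Y : rooted_Rtree R,
    [/\ in_Tge3 X /\ quasi_isometric Z X, in_Tge3 Y /\ quasi_isometric Z Y &
        bd_equiv X Y -> M < varrho X Y].
Proof.
pose E := end_lev hZ; have [F0 _] := end_inhabited hZ.
have [code [code_eq code_flip]] := @codes_exist E F0.
pose n := (Num.truncn (expR M)).+1.
pose X := level_tree R (F0 : shallow E n).
pose Y := level_tree R (F0 : deep n code_eq code_flip).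
have hX : in_Tge3 X := @level_tree_Tge3 R (shallow E n) F0 (@shallow_branching E n).
have hY : in_Tge3 Y := 
  @level_tree_Tge3 R (deep n code_eq code_flip) F0
    (@deep_branching E code n code_eq code_flip (ltn0Sn _)).
exists X, Y; split.
- split => //; apply: (@chart_qi R E (shallow E n) _ _ _ _ (fun F => F) n.*2.+1
    (end_chart hZ) (lpt_chart R _)); first by exists id.
  by move=> F G _; exact: shallow_close.
- split => //; apply: (@chart_qi R E (deep n code_eq code_flip) _ _ _ _ (fun F => F)
    n.*2.+1 (end_chart hZ) (lpt_chart R _)); first by exists id.
  by move=> F G _; exact: deep_close.
move=> [hX' [hY' [k0 e]]]; have [k [ek _ ->]] := varrho_levels e.
have nk := distant_trees ek.
have pos : 0 < 1 + 2 * k%:R :> R by rewrite ltr_wpDr// mulr_ge0.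
rewrite -(expRK M) ltr_ln ?posrE ?expR_gt0//.
apply: lt_le_trans (truncnS_gt _) _; rewrite -/n.
have : n%:R <= k%:R :> R by rewrite ler_nat.
by have := ler0n R k; lra.
Qed.

Theorem theorem1p2 (R : realType) (Z : rooted_Rtree R) (hZ : in_Tge3 Z) :
  is_metric_mod (qi_class Z) (@rooted_isometric R) (@varrho R) /\
  (forall M : R, exists X Y : rooted_Rtree R,
     [/\ qi_class Z X, qi_class Z Y & M < varrho X Y]) /\
  (forall X Y : rooted_Rtree R, qi_class Z X -> qi_class Z Y ->
     (varrho X Y = 0 <-> rooted_isometric X Y)).
Proof.
have cmp X Y : qi_class Z X -> qi_class Z Y -> bd_equiv X Y.
  move=> [hX ZX] [hY ZY]; apply: bd_equiv_trans (qi_bd_equiv hZ hY ZY).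
  exact/bd_equiv_sym/qi_bd_equiv.
split; [split|split].
- by move=> X Y /cmp h /h; exact: varrho_ge0.
- by move=> X Y /cmp h /h; exact: varrho_eq0.
- by move=> X Y _ _; exact: varrho_sym.
- move=> X Y W cX cY cW; exact: (varrho_triangle (cmp _ _ cX cY) (cmp _ _ cY cW)).
- move=> X X' Y Y' cX cX' cY cY' XX' YY'.
  have tri A B C : qi_class Z A -> qi_class Z B -> qi_class Z C ->
      varrho A C <= varrho A B + varrho B C.
    by move=> cA cB cC; exact: (varrho_triangle (cmp _ _ cA cB) (cmp _ _ cB cC)).
  have X0 := (varrho_eq0 (cmp _ _ cX cX')).2 XX'.
  have Y0 := (varrho_eq0 (cmp _ _ cY cY')).2 YY'.
  have X0' := varrho_sym X X'; have Y0' := varrho_sym Y Y'.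
  have := tri _ _ _ cX cX' cY; have := tri _ _ _ cX' cX cY.
  have := tri _ _ _ cX' cY cY'; have := tri _ _ _ cX' cY' cY.
  by move=> *; apply/le_anti/andP; split; lra.
- move=> M; have [X [Y [cX cY h]]] := varrho_unbounded hZ M.
  by exists X, Y; split => //; apply: h; exact: cmp.
- by move=> X Y /cmp h /h; exact: varrho_eq0.
Qed.
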